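(* Let $k, n$ be positive integers and let $\tau$ be a real trigonometric polynomial of degree at most $n$. Write $c_n(t)=\cos(nt)$. Then for every $h\in(0,2\pi/n]$ with $h<\pi/k$, $$\| D^{2k}\tau \| \le n^{2k}\, \bigl(W_{2k}(c_n,h)\bigr)^{-1}\, W_{2k}(\tau,h).$$
   Context: $T=\mathbb{R}/(2\pi\mathbb{Z})$ is the one-dimensional torus; functions on $T$ are $2\pi$-periodic functions on $\mathbb{R}$. $\|\cdot\|$ is the uniform (sup) norm over $T$, and $D^{m}$ denotes the $m$-th derivative. For a positive integer $k$, a continuous function $f$ on $T$, and $t\in\mathbb{R}$, the even central difference is $$\widehat\Delta_t^{2k} f(x)=\sum_{j=-k}^{k}(-1)^j\binom{2k}{k+j} f(x+jt).$$ For $0<h<\pi/k$ let $\phi_h(t)=\frac1h\left(1-\frac{|t|}{h}\right)$ for $t\in[-h,h]$ and $\phi_h(t)=0$ for all other $t\in[-\pi,\pi]$, and define $$W_{2k}(f,x,h)=\binom{2k}{k}^{-1}\int_T \widehat\Delta_t^{2k} f(x)\,\phi_h(t)\,dt=\binom{2k}{k}^{-1}\int_{-h}^{h} \widehat\Delta_t^{2k} f(x)\,\phi_h(t)\,dt ,$$ $$W_{2k}(f,h)=\|W_{2k}(f,\cdot,h)\|=\sup_{x\in T}|W_{2k}(f,x,h)|.$$ *)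

(* Defs.v *)
From Stdlib Require Import Reals ZArith.
From Coquelicot Require Import Coquelicot.
Open Scope R_scope.

(* Functions on the torus R/(2 PI Z) are 2 PI-periodic functions R -> R, so the
   supremum over the torus is the supremum over R.  The least upper bound is
   taken in Rbar and projected to R; the projection is only meaningful when f is
   bounded, as continuous periodic functions are. *)
Definition sup_norm (f : R -> R) : R :=
  real (Lub_Rbar (fun y => exists x : R, y = Rabs (f x))).

Definition trig_poly (n : nat) (tau : R -> R) : Prop :=
  exists a b : nat -> R, forall x : R,
    tau x = sum_n (fun j => a j * cos (INR j * x) + b j * sin (INR j * x)) n.

(* The index i = k + j runs over 0, ..., 2k while j runs over -k, ..., k.
   Binomial.C is the real-valued binomial coefficient (the bare name C is
   Coquelicot's type of complex numbers). *)
Definition central_diff (k : nat) (t : R) (f : R -> R) (x : R) : R :=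
  sum_n (fun i =>
    let j := (Z.of_nat i - Z.of_nat k)%Z in
    powerRZ (-1) j * Binomial.C (2 * k) i * f (x + IZR j * t)) (2 * k).

(* Values of the kernel for t in [-PI, PI]. *)
Definition phi (h t : R) : R :=
  if Rle_dec (Rabs t) h then / h * (1 - Rabs t / h) else 0.

Definition W_at (k : nat) (f : R -> R) (x h : R) : R :=
  / Binomial.C (2 * k) k *
  RInt (fun t => central_diff k t f x * phi h t) (- PI) PI.

Definition W (k : nat) (f : R -> R) (h : R) : R :=
  sup_norm (fun x => W_at k f x h).

(* Main.v *)
Require Import Defs.
From Stdlib Require Import Reals ZArith Lra Lia FunctionalExtensionality.
From Coquelicot Require Import Coquelicot.
Open Scope R_scope.

(** Both D^{2k} and W_{2k}(., h) are Fourier multipliers.  The central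
    difference multiplies cos(m x) by (2 sin(m t / 2))^{2k}, so W_{2k} multiplies
    it by lambda_m = w_m / binom(2k, k) with w_m the integral of
    (2 sin(m t / 2))^{2k} phi_h(t) ([W_at_trig_sum]), while D^{2k} multiplies it
    by (-1)^k m^{2k}.  Hence, up to sign, D^{2k} tau is obtained from
    W_{2k}(tau, ., h) by the multiplier e_m = m^{2k} / lambda_m.  Since
    W_{2k}(c_n, h) = lambda_n, the claim is exactly that this multiplier has norm
    at most e_n on trigonometric polynomials of degree at most n.

    That bound follows from the shape of e alone ([convex_multiplier_bound]).
    Suppose that e_0, ..., e_n are nonnegative and that their even
    2n-periodic extension has nonnegative second differences except at n.  The
    discrete cosine transform writes e as a combination of the 2n multipliers of
    the translations x -> x + s PI / n, with coefficients whose signs are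
    (-1)^s, by a double summation by parts.  So the multiplier is a combination
    of translations, and its norm is at most the sum of the absolute values of
    the coefficients; this sum is the alternating sum, which is the value of the
    extension at n.

    It remains to see that e is convex.  Put q = 2k, p = q + 2, y = m h / 2,
    which is at most PI because h <= 2 PI / n.  Let H be the second primitive of
    sin^q vanishing to second order at 0.  Because phi_h is a triangle,
    w_m = 2 2^q H(y) / y^2, and therefore e_m is a constant times
    y^p / H(y).  The analytic heart is that r(y) = y^p / H(y) is
    nondecreasing and convex on (0, PI] ([power_ratio_mono],
    [power_ratio_convex]).  The value e_0 is free, because lambda_0 = 0 and
    D^{2k} kills constants; e_0 = e_1 keeps the sequence convex.

    For the convexity of r write K = H', S = H'' = sin^q, U = p H - y K,
    D = U' H - U K.  Then r' = y^{p-1} U / H^2, and r'' has the sign of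
    U^2 - U H + y D.  Everything rests on one comparison of U with the defect
    d = q (1 - y cot y) of the logarithmic derivative of S:
    (p+1)(p+2) U <= p (p-1) d H ([defect_le_cot_defect]), which integrates
    twice the inequality y d' >= 2 d.  It gives D >= 0, so U / H is
    nondecreasing.  Where U >= H, this already yields r'' >= 0.  Where U <= H,
    the stronger statement y D >= U H holds, because
    (y D - U H) H / (y^2 S) vanishes at 0 and is nondecreasing there
    ([log_concavity_nonneg]).  That statement, which says that H / y^p is
    log-concave, can fail near PI, which is why two cases are needed. *)

(** * Signs from derivatives *)

Lemma nonneg_of_deriv (f f' : R -> R) (y : R) :
  0 <= y -> 0 <= f 0 ->
  (forall t, 0 <= t <= y -> is_derive f t (f' t)) ->
  (forall t, 0 < t < y -> 0 <= f' t) -> 0 <= f y.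
Proof.
  intros [Hy|<-] H0 Hd Hp; [|exact H0].
  destruct (MVT_cor2 f f' 0 y Hy) as [c [Hc1 Hc2]].
  { intros c Hc; apply is_derive_Reals, Hd, Hc. }
  specialize (Hp c Hc2). nra.
Qed.

(** Variant for functions that involve cot or a quotient, whose formal value at
    0 is an artefact of division by zero: a linear lower bound near 0 replaces
    the sign at 0. *)
Lemma nonneg_of_deriv_at_right (f f' : R -> R) (c y : R) :
  0 < y ->
  (forall t, 0 < t < y -> t <= 1 -> - (c * t) <= f t) ->
  (forall t, 0 < t <= y -> is_derive f t (f' t)) ->
  (forall t, 0 < t < y -> 0 <= f' t) -> 0 <= f y.
Proof.
  intros Hy H0 Hd Hp.
  apply Rnot_lt_le; intros Hn.
  set (e := Rmin (Rmin (y / 2) 1) (- f y / (2 * (1 + Rabs c)))).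
  pose proof (Rabs_pos c) as Hc.
  assert (He : 0 < e).
  { unfold e; repeat apply Rmin_glb_lt; try lra.
    apply Rdiv_lt_0_compat; lra. }
  assert (H1 : e <= y / 2).
  { unfold e; eapply Rle_trans; [apply Rmin_l|apply Rmin_l]. }
  assert (H2 : e <= 1).
  { unfold e; eapply Rle_trans; [apply Rmin_l|apply Rmin_r]. }
  assert (H3 : e * (2 * (1 + Rabs c)) <= - f y).
  { apply Rle_div_r; [lra|]; apply Rmin_r. }
  assert (H4 : c * e <= Rabs c * e).
  { apply Rmult_le_compat_r; [lra|apply Rle_abs]. }
  specialize (H0 e ltac:(lra) H2).
  destruct (MVT_cor2 f f' e y ltac:(lra)) as [x [Hx1 Hx2]].
  { intros x Hx; apply is_derive_Reals, Hd; lra. }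
  specialize (Hp x ltac:(lra)). nra.
Qed.

(** * Iterated primitives of sine powers *)

Definition sin_int (q : nat) (y : R) : R := RInt (fun v => sin v ^ q) 0 y.
Definition sin_int2 (q : nat) (y : R) : R := RInt (sin_int q) 0 y.

Lemma sin_int_0 q : sin_int q 0 = 0.
Proof. exact (RInt_point _ _). Qed.
Lemma sin_int2_0 q : sin_int2 q 0 = 0.
Proof. exact (RInt_point _ _). Qed.

Lemma is_derive_sin_pow q y :
  is_derive (fun v => sin v ^ q) y (INR q * cos y * sin y ^ (pred q)).
Proof. auto_derive; [easy|ring]. Qed.

Lemma is_derive_primitive (f : R -> R) y :
  (forall x, continuous f x) -> is_derive (fun y => RInt f 0 y) y (f y).
Proof.
  intros Hf. apply is_derive_RInt with 0; [|apply Hf].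
  apply filter_forall; intros x. apply RInt_correct, ex_RInt_continuous; auto.
Qed.

Lemma is_derive_sin_int q y : is_derive (sin_int q) y (sin y ^ q).
Proof.
  apply (is_derive_primitive (fun v => sin v ^ q)).
  intros x; apply (ex_derive_continuous (V := R_NormedModule)); eexists;
    apply is_derive_sin_pow.
Qed.

Lemma is_derive_sin_int2 q y : is_derive (sin_int2 q) y (sin_int q y).
Proof.
  apply is_derive_primitive.
  intros x; apply (ex_derive_continuous (V := R_NormedModule)); eexists;
    apply is_derive_sin_int.
Qed.


(** The two primitives are hidden behind variables because comparing them with
    each other by conversion unfolds both integrals. *)
Ltac derive_sin_int q :=
  let E1 := fresh in let E2 := fresh in let K := fresh in let H := fresh in
  pose proof (is_derive_sin_int q) as E1; pose proof (is_derive_sin_int2 q) as E2;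
  revert E1 E2; generalize (sin_int q) (sin_int2 q); intros K H E1 E2;
  auto_derive;
  [ repeat split; auto; eexists; eauto
  | rewrite ?(fun y => is_derive_unique (fun x : R => K x) y _ (E1 y)),
            ?(fun y => is_derive_unique (fun x : R => H x) y _ (E2 y)) ].

Lemma pow_sin_split q y : (0 < q)%nat -> sin y ^ q = sin y * sin y ^ pred q.
Proof. destruct q as [|q]; [lia|reflexivity]. Qed.

Lemma sin_pow_pos q y : 0 < y < PI -> 0 < sin y ^ q.
Proof. intros Hy; apply pow_lt, sin_gt_0; lra. Qed.

Lemma sin_pow_bounds q y : 0 <= y <= PI -> 0 <= sin y ^ q <= 1.
Proof.
  intros Hy. assert (H : 0 <= sin y <= 1).
  { split; [apply sin_ge_0; lra|apply SIN_bound]. }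
  split; [apply pow_le; lra|]. rewrite <- (pow1 q); apply pow_incr; exact H.
Qed.

Lemma sin_int_pos q y : 0 < y <= PI -> 0 < sin_int q y.
Proof.
  intros Hy.
  destruct (MVT_cor2 (sin_int q) (fun v => sin v ^ q) 0 y ltac:(lra)) as [c [Hc1 Hc2]].
  { intros c _; apply is_derive_Reals, is_derive_sin_int. }
  rewrite sin_int_0 in Hc1. pose proof (sin_pow_pos q c ltac:(lra)). nra.
Qed.

Lemma sin_int2_pos q y : 0 < y <= PI -> 0 < sin_int2 q y.
Proof.
  intros Hy.
  destruct (MVT_cor2 (sin_int2 q) (sin_int q) 0 y ltac:(lra)) as [c [Hc1 Hc2]].
  { intros c _; apply is_derive_Reals, is_derive_sin_int2. }
  rewrite sin_int2_0 in Hc1. pose proof (sin_int_pos q c ltac:(lra)). nra.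
Qed.

Lemma sin_int_le_id q y : 0 <= y <= PI -> sin_int q y <= y.
Proof.
  intros Hy.
  enough (0 <= y - sin_int q y) by lra.
  apply (nonneg_of_deriv (fun y => y - sin_int q y) (fun y => 1 - sin y ^ q));
    [lra|rewrite sin_int_0; lra| |].
  - intros t _. derive_sin_int q. ring.
  - intros t Ht. pose proof (sin_pow_bounds q t ltac:(lra)). lra.
Qed.

Lemma sin_int2_le_id q y : 0 <= y <= 1 -> sin_int2 q y <= y.
Proof.
  intros Hy. pose proof PI2_3_2.
  enough (0 <= y - sin_int2 q y) by lra.
  apply (nonneg_of_deriv (fun y => y - sin_int2 q y) (fun y => 1 - sin_int q y));
    [lra|rewrite sin_int2_0; lra| |].
  - intros t _. derive_sin_int q. ring.
  - intros t Ht. pose proof (sin_int_le_id q t ltac:(lra)). lra.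
Qed.

(** The power of the sine is increasing near 0, so its mean is at most its last
    value. *)
Lemma sin_int_le_near_0 q y : 0 <= y <= 1 -> sin_int q y <= y * sin y ^ q.
Proof.
  intros Hy. pose proof PI2_3_2.
  enough (0 <= y * sin y ^ q - sin_int q y) by lra.
  apply (nonneg_of_deriv (fun y => y * sin y ^ q - sin_int q y)
           (fun y => y * (INR q * cos y * sin y ^ pred q)));
    [lra|rewrite sin_int_0; lra| |].
  - intros t _. derive_sin_int q. ring.
  - intros t Ht. pose proof (sin_pow_pos (pred q) t ltac:(lra)).
    pose proof (pos_INR q). pose proof (cos_ge_0 t ltac:(lra) ltac:(lra)).
    repeat apply Rmult_le_pos; lra.
Qed.

Lemma sin_int2_le_near_0 q y : 0 <= y <= 1 -> sin_int2 q y <= y ^ 2 * sin y ^ q.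
Proof.
  intros Hy. pose proof PI2_3_2.
  assert (H1 : 0 <= y * sin_int q y - sin_int2 q y).
  { apply (nonneg_of_deriv (fun y => y * sin_int q y - sin_int2 q y)
           (fun y => y * sin y ^ q)); [lra|rewrite sin_int2_0; lra| |].
    - intros t _. derive_sin_int q. ring.
    - intros t Ht. pose proof (sin_pow_pos q t ltac:(lra)). nra. }
  pose proof (sin_int_le_near_0 q y Hy). nra.
Qed.

(** * The logarithmic derivative of a power of the sine *)

(** For S = sin^q this is q - y S' / S: the amount by which the logarithmic
    derivative y S' / S has dropped from its value q at 0. *)
Definition cot_defect (q : nat) (y : R) : R := INR q * (1 - y * cos y / sin y).

Definition cot_defect' (q : nat) (y : R) : R :=
  INR q * (y / sin y ^ 2 - cos y / sin y).

Lemma is_derive_cot_defect q y : 0 < y < PI -> is_derive (cot_defect q) y (cot_defect' q y).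
Proof.
  intros Hy. pose proof (sin_gt_0 y ltac:(lra) ltac:(lra)) as Hs.
  unfold cot_defect, cot_defect'. auto_derive; [lra|].
  pose proof (sin2_cos2 y) as E; unfold Rsqr in E.
  replace (y / sin y ^ 2) with (y * (sin y * sin y + cos y * cos y) / sin y ^ 2)
    by (rewrite E; field; lra).
  field; lra.
Qed.

Lemma sin_minus_cos_nonneg y : 0 <= y <= PI -> 0 <= sin y - y * cos y.
Proof.
  intros Hy.
  apply (nonneg_of_deriv (fun y => sin y - y * cos y) (fun y => y * sin y)); [lra| | |].
  - rewrite sin_0; lra.
  - intros t _. auto_derive; [easy|ring].
  - intros t Ht. pose proof (sin_gt_0 t ltac:(lra) ltac:(lra)). nra.
Qed.

(** The difference vanishes to second order at 0, and its second derivative is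
    4 sin y (sin y - y cos y). *)
Lemma sin_sqr_le y : 0 <= y <= PI -> 2 * sin y ^ 2 <= y ^ 2 + y * sin y * cos y.
Proof.
  intros Hy.
  assert (H1 : forall t, 0 <= t <= PI ->
    0 <= 2 * t - 3 * sin t * cos t + t * (cos t ^ 2 - sin t ^ 2)).
  { intros t Ht.
    apply (nonneg_of_deriv
      (fun t => 2 * t - 3 * sin t * cos t + t * (cos t ^ 2 - sin t ^ 2))
      (fun t => 4 * sin t * (sin t - t * cos t))); [lra| | |].
    - rewrite sin_0; lra.
    - intros x _. auto_derive; [easy|].
      pose proof (sin2_cos2 x) as E; unfold Rsqr in E.
      replace (2 * 1) with (2 * (sin x * sin x + cos x * cos x)) by (rewrite E; ring).
      ring.
    - intros x Hx. pose proof (sin_gt_0 x ltac:(lra) ltac:(lra)).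
      pose proof (sin_minus_cos_nonneg x ltac:(lra)). nra. }
  enough (0 <= y ^ 2 + y * sin y * cos y - 2 * sin y ^ 2) by lra.
  apply (nonneg_of_deriv (fun y => y ^ 2 + y * sin y * cos y - 2 * sin y ^ 2)
   (fun t => 2 * t - 3 * sin t * cos t + t * (cos t ^ 2 - sin t ^ 2))); [lra| | |].
  - rewrite sin_0; lra.
  - intros x _. auto_derive; [easy|ring].
  - intros t Ht; apply H1; lra.
Qed.

Lemma cot_defect_nonneg q y : 0 < y < PI -> 0 <= cot_defect q y.
Proof.
  intros Hy. pose proof (sin_gt_0 y ltac:(lra) ltac:(lra)) as Hs.
  pose proof (sin_minus_cos_nonneg y ltac:(lra)) as H.
  unfold cot_defect. apply Rmult_le_pos; [apply pos_INR|].
  replace (1 - y * cos y / sin y) with ((sin y - y * cos y) / sin y) by (field; lra).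
  apply Rdiv_le_0_compat; lra.
Qed.

(** 1 - y cot y is a power series in y^2 without constant term and with
    nonnegative coefficients, so it grows at least like y^2. *)
Lemma cot_defect_growth q y : 0 < y < PI -> 2 * cot_defect q y <= y * cot_defect' q y.
Proof.
  intros Hy. pose proof (sin_gt_0 y ltac:(lra) ltac:(lra)) as Hs.
  pose proof (sin_sqr_le y ltac:(lra)) as H.
  enough (0 <= y * cot_defect' q y - 2 * cot_defect q y) by lra.
  unfold cot_defect, cot_defect'.
  replace (y * (INR q * (y / sin y ^ 2 - cos y / sin y)) -
     2 * (INR q * (1 - y * cos y / sin y)))
    with (INR q * ((y ^ 2 + y * sin y * cos y - 2 * sin y ^ 2) / sin y ^ 2))
    by (field; lra).
  apply Rmult_le_pos; [apply pos_INR|].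
  apply Rdiv_le_0_compat; [lra|apply pow_lt; lra].
Qed.

Lemma sin_pow_logderiv q y : (0 < q)%nat -> 0 < y < PI ->
  INR q * sin y ^ q - y * (INR q * cos y * sin y ^ pred q) = cot_defect q y * sin y ^ q.
Proof.
  intros Hq Hy. pose proof (sin_gt_0 y ltac:(lra) ltac:(lra)) as Hs.
  rewrite (pow_sin_split q y Hq). unfold cot_defect. field; lra.
Qed.

(** * The second primitive of a sine power compared with a power *)

(** For the second primitive H of sin^q, whose order of vanishing at 0 is q + 2,
    the quotient defect / H is q + 2 - y H' / H.  It is the analogue for H of
    [cot_defect]. *)
Definition defect (q : nat) (y : R) : R := (INR q + 2) * sin_int2 q y - y * sin_int q y.
Definition defect' (q : nat) (y : R) : R := (INR q + 1) * sin_int q y - y * sin y ^ q.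

Lemma is_derive_defect q y : is_derive (defect q) y (defect' q y).
Proof. unfold defect, defect'. derive_sin_int q. ring. Qed.

Lemma is_derive_defect' q y : (0 < q)%nat -> 0 < y < PI ->
  is_derive (defect' q) y (cot_defect q y * sin y ^ q).
Proof.
  intros Hq Hy. rewrite <- sin_pow_logderiv by assumption.
  unfold defect'. derive_sin_int q. ring.
Qed.

Lemma defect'_nonneg q y : (0 < q)%nat -> 0 < y < PI -> 0 <= defect' q y.
Proof.
  intros Hq Hy.
  apply (nonneg_of_deriv_at_right (defect' q) (fun y => cot_defect q y * sin y ^ q) 1);
    [lra| | |].
  - intros t Ht Ht1. unfold defect'. pose proof (sin_pow_bounds q t ltac:(lra)).
    pose proof (sin_int_pos q t ltac:(lra)). pose proof (pos_INR q). nra.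
  - intros t Ht; apply is_derive_defect'; [exact Hq|lra].
  - intros t Ht. apply Rmult_le_pos; [apply cot_defect_nonneg; lra|].
    apply Rlt_le, sin_pow_pos; lra.
Qed.

Lemma defect_nonneg q y : (0 < q)%nat -> 0 < y < PI -> 0 <= defect q y.
Proof.
  intros Hq Hy.
  apply (nonneg_of_deriv (defect q) (defect' q)); [lra| | |].
  - unfold defect; rewrite sin_int2_0; lra.
  - intros t _; apply is_derive_defect.
  - intros t Ht; apply defect'_nonneg; [exact Hq|lra].
Qed.

(** Each of the two integrations that lead from sin^q to its second primitive
    gains one factor: the orders of vanishing at 0 are q + 1 and q + 2, and the
    defect vanishes two orders later. *)
Definition excess_factor (q : nat) : R :=
  (1 + 2 / (INR q + 2)) * (1 + 2 / (INR q + 1)).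

(** First of the two integrations.  The derivative of the difference is
    controlled by [cot_defect_growth] and by sin^q <= (q+1) K / y, where K is the
    first primitive. *)
Lemma defect'_le_cot_defect q y : (0 < q)%nat -> 0 < y < PI ->
  excess_factor q * defect' q y <= (1 + 2 / (INR q + 2)) * (cot_defect q y * sin_int q y).
Proof.
  intros Hq Hy. pose proof (pos_INR q) as Hq0.
  set (a := 1 + 2 / (INR q + 2)). set (b := 1 + 2 / (INR q + 1)).
  assert (Ha : 0 < a) by (unfold a; pose proof (Rdiv_lt_0_compat 2 (INR q + 2)); lra).
  assert (Hb : 0 < b) by (unfold b; pose proof (Rdiv_lt_0_compat 2 (INR q + 1)); lra).
  change (excess_factor q) with (a * b).
  enough (0 <= cot_defect q y * sin_int q y - b * defect' q y) by nra.
  apply (nonneg_of_deriv_at_right (fun y => cot_defect q y * sin_int q y - b * defect' q y)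
    (fun y => cot_defect' q y * sin_int q y + cot_defect q y * sin y ^ q
              - b * (cot_defect q y * sin y ^ q))
    (b * (INR q + 1))); [lra| | |].
  - intros t Ht Ht1. pose proof (cot_defect_nonneg q t ltac:(lra)) as H1.
    pose proof (sin_int_pos q t ltac:(lra)) as H2.
    pose proof (sin_int_le_id q t ltac:(lra)) as H3.
    pose proof (sin_pow_bounds q t ltac:(lra)) as H4.
    assert (defect' q t <= (INR q + 1) * t) by (unfold defect'; nra).
    assert (0 <= cot_defect q t * sin_int q t) by nra. nra.
  - intros t Ht.
    apply (is_derive_minus (fun y => cot_defect q y * sin_int q y)
             (fun y => b * defect' q y)).
    + apply (is_derive_mult (K := R_AbsRing) (cot_defect q) (sin_int q)).
      * apply is_derive_cot_defect; lra.
      * apply is_derive_sin_int.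
      * intros n m; apply Rmult_comm.
    + apply (is_derive_scal (defect' q)). apply is_derive_defect'; [exact Hq|lra].
  - intros t Ht. pose proof (cot_defect_nonneg q t ltac:(lra)) as H1.
    pose proof (sin_pow_pos q t ltac:(lra)) as H2.
    pose proof (sin_int_pos q t ltac:(lra)) as H3.
    pose proof (cot_defect_growth q t ltac:(lra)) as H4.
    pose proof (defect'_nonneg q t Hq ltac:(lra)) as H5. unfold defect' in H5.
    assert (Hb2 : (b - 1) * (INR q + 1) = 2) by (unfold b; field; lra).
    enough (0 <= t * ((INR q + 1) * (cot_defect' q t * sin_int q t
                        - (b - 1) * (cot_defect q t * sin t ^ q)))).
    { apply Rmult_le_reg_l with (t * (INR q + 1)); [apply Rmult_lt_0_compat; lra|].
      lra. }
    replace (t * ((INR q + 1) * (cot_defect' q t * sin_int q t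
                    - (b - 1) * (cot_defect q t * sin t ^ q))))
      with ((INR q + 1) * sin_int q t * (t * cot_defect' q t - 2 * cot_defect q t)
         + 2 * cot_defect q t * ((INR q + 1) * sin_int q t - t * sin t ^ q)
         + (2 - (b - 1) * (INR q + 1)) * t * (cot_defect q t * sin t ^ q)) by ring.
    rewrite Hb2. replace (2 - 2) with 0 by ring.
    assert (0 <= (INR q + 1) * sin_int q t * (t * cot_defect' q t - 2 * cot_defect q t))
      by (apply Rmult_le_pos; [apply Rmult_le_pos|]; lra).
    assert (0 <= 2 * cot_defect q t * ((INR q + 1) * sin_int q t - t * sin t ^ q))
      by (apply Rmult_le_pos; lra).
    lra.
Qed.

(** Taking primitives lowers the defect by a definite factor: the quotient
    defect / H at y is an average of values of [cot_defect] on [0, y], and these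
    grow at least quadratically. *)
Lemma defect_le_cot_defect q y : (0 < q)%nat -> 0 < y < PI ->
  excess_factor q * defect q y <= cot_defect q y * sin_int2 q y.
Proof.
  intros Hq Hy. pose proof (pos_INR q) as Hq0.
  assert (Hk : 0 < excess_factor q).
  { unfold excess_factor. pose proof (Rdiv_lt_0_compat 2 (INR q + 2)).
    pose proof (Rdiv_lt_0_compat 2 (INR q + 1)). nra. }
  enough (0 <= cot_defect q y * sin_int2 q y - excess_factor q * defect q y) by lra.
  apply (nonneg_of_deriv_at_right
    (fun y => cot_defect q y * sin_int2 q y - excess_factor q * defect q y)
    (fun y => cot_defect' q y * sin_int2 q y + cot_defect q y * sin_int q y
              - excess_factor q * defect' q y)
    (excess_factor q * (INR q + 2))); [lra| | |].
  - intros t Ht Ht1. pose proof (cot_defect_nonneg q t ltac:(lra)) as H1.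
    pose proof (sin_int2_pos q t ltac:(lra)) as H2.
    pose proof (sin_int_pos q t ltac:(lra)) as H2'.
    pose proof (sin_int2_le_id q t ltac:(lra)) as H3.
    assert (defect q t <= (INR q + 2) * t) by (unfold defect; nra).
    assert (0 <= cot_defect q t * sin_int2 q t) by nra. nra.
  - intros t Ht.
    apply (is_derive_minus (fun y => cot_defect q y * sin_int2 q y)
             (fun y => excess_factor q * defect q y)).
    + apply (is_derive_mult (K := R_AbsRing) (cot_defect q) (sin_int2 q)).
      * apply is_derive_cot_defect; lra.
      * apply is_derive_sin_int2.
      * intros n m; apply Rmult_comm.
    + apply (is_derive_scal (defect q)). apply is_derive_defect.
  - intros t Ht. pose proof (cot_defect_nonneg q t ltac:(lra)) as H1.
    pose proof (sin_int2_pos q t ltac:(lra)) as H3.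
    pose proof (cot_defect_growth q t ltac:(lra)) as H4.
    pose proof (defect_nonneg q t Hq ltac:(lra)) as H5. unfold defect in H5.
    pose proof (defect'_le_cot_defect q t Hq ltac:(lra)) as H6.
    assert (H7 : 2 / (INR q + 2) * (cot_defect q t * sin_int q t) <=
      cot_defect' q t * sin_int2 q t); [|lra].
    apply Rmult_le_reg_l with (t * (INR q + 2)); [apply Rmult_lt_0_compat; lra|].
    replace (t * (INR q + 2) * (2 / (INR q + 2) * (cot_defect q t * sin_int q t)))
      with (2 * cot_defect q t * (t * sin_int q t)) by (field; lra).
    assert (2 * cot_defect q t * (t * sin_int q t) <=
      2 * cot_defect q t * ((INR q + 2) * sin_int2 q t))
      by (apply Rmult_le_compat_l; lra).
    assert (0 <= (INR q + 2) * sin_int2 q t * (t * cot_defect' q t - 2 * cot_defect q t))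
      by (apply Rmult_le_pos; [apply Rmult_le_pos|]; lra).
    lra.
Qed.

Lemma excess_factor_minus_1 q :
  excess_factor q - 1 = (4 * INR q + 10) / ((INR q + 2) * (INR q + 1)).
Proof. pose proof (pos_INR q). unfold excess_factor. field; lra. Qed.

Lemma cot_defect_excess q y : (0 < q)%nat -> 0 < y < PI ->
  (4 * INR q + 10) * defect q y <=
  (INR q + 2) * (INR q + 1) * (cot_defect q y * sin_int2 q y - defect q y).
Proof.
  intros Hq Hy. pose proof (pos_INR q).
  pose proof (defect_le_cot_defect q y Hq Hy) as H1.
  assert (H2 : (excess_factor q - 1) * defect q y <=
    cot_defect q y * sin_int2 q y - defect q y) by lra.
  rewrite excess_factor_minus_1 in H2.
  apply Rmult_le_compat_l with (r := (INR q + 2) * (INR q + 1)) in H2;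
    [|apply Rmult_le_pos; lra].
  replace ((INR q + 2) * (INR q + 1) *
     ((4 * INR q + 10) / ((INR q + 2) * (INR q + 1)) * defect q y))
   with ((4 * INR q + 10) * defect q y) in H2 by (field; lra).
  exact H2.
Qed.

Lemma cot_defect_excess_nonneg q y : (0 < q)%nat -> 0 < y < PI ->
  0 <= cot_defect q y * sin_int2 q y - defect q y.
Proof.
  intros Hq Hy. pose proof (pos_INR q).
  pose proof (defect_nonneg q y Hq Hy). pose proof (cot_defect_excess q y Hq Hy).
  apply Rmult_le_reg_l with ((INR q + 2) * (INR q + 1)); [apply Rmult_lt_0_compat; lra|].
  assert (0 <= (4 * INR q + 10) * defect q y) by (apply Rmult_le_pos; lra). lra.
Qed.

(** The numerator of the derivative of defect / H. *)
Definition wronskian (q : nat) (y : R) : R :=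
  defect' q y * sin_int2 q y - defect q y * sin_int q y.

Lemma is_derive_wronskian q y : (0 < q)%nat -> 0 < y < PI ->
  is_derive (wronskian q) y (sin y ^ q * (cot_defect q y * sin_int2 q y - defect q y)).
Proof.
  intros Hq Hy.
  evar_last.
  - apply (is_derive_minus (fun y => defect' q y * sin_int2 q y)
             (fun y => defect q y * sin_int q y)).
    + apply (is_derive_mult (K := R_AbsRing) (defect' q) (sin_int2 q)).
      * apply is_derive_defect'; assumption.
      * apply is_derive_sin_int2.
      * intros n m; apply Rmult_comm.
    + apply (is_derive_mult (K := R_AbsRing) (defect q) (sin_int q)).
      * apply is_derive_defect.
      * apply is_derive_sin_int.
      * intros n m; apply Rmult_comm.
  - unfold minus, plus, opp, mult; simpl. ring.
Qed.

(** The derivative is sin^q (d H - U) with d = [cot_defect] and U = [defect]: the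
    terms that contain the first primitive cancel. *)
Lemma wronskian_nonneg q y : (0 < q)%nat -> 0 < y < PI -> 0 <= wronskian q y.
Proof.
  intros Hq Hy. pose proof (pos_INR q).
  apply (nonneg_of_deriv_at_right (wronskian q)
    (fun y => sin y ^ q * (cot_defect q y * sin_int2 q y - defect q y)) (INR q + 2));
    [lra| | |].
  - intros t Ht Ht1. unfold wronskian.
    pose proof (sin_int2_pos q t ltac:(lra)) as H2.
    pose proof (sin_int_pos q t ltac:(lra)) as H3.
    pose proof (sin_int_le_id q t ltac:(lra)) as H4.
    pose proof (sin_int2_le_id q t ltac:(lra)) as H5.
    pose proof (defect'_nonneg q t Hq ltac:(lra)) as H6.
    pose proof (defect_nonneg q t Hq ltac:(lra)) as H7.
    assert (H8 : defect q t <= (INR q + 2) * t) by (unfold defect; nra).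
    assert (0 <= defect' q t * sin_int2 q t) by nra.
    assert (defect q t * sin_int q t <= defect q t * 1) by (apply Rmult_le_compat_l; lra).
    lra.
  - intros t Ht. apply is_derive_wronskian; [exact Hq|lra].
  - intros t Ht. apply Rmult_le_pos; [|apply cot_defect_excess_nonneg; [exact Hq|lra]].
    apply Rlt_le, sin_pow_pos; lra.
Qed.

Lemma defect_ratio_mono q x y : (0 < q)%nat -> 0 < x <= y -> y < PI ->
  defect q x / sin_int2 q x <= defect q y / sin_int2 q y.
Proof.
  intros Hq [Hx [Hxy|<-]] Hy; [|lra].
  destruct (MVT_cor2 (fun y => defect q y / sin_int2 q y)
    (fun y => wronskian q y / sin_int2 q y ^ 2) x y Hxy) as [c [Hc1 Hc2]].
  - intros c Hc. apply is_derive_Reals.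
    pose proof (sin_int2_pos q c ltac:(lra)).
    evar_last.
    + apply is_derive_div; [apply is_derive_defect|apply is_derive_sin_int2|lra].
    + unfold wronskian; simpl; field; lra.
  - pose proof (wronskian_nonneg q c Hq ltac:(lra)).
    pose proof (sin_int2_pos q c ltac:(lra)).
    assert (0 <= wronskian q c / sin_int2 q c ^ 2)
      by (apply Rdiv_le_0_compat; [lra|apply pow_lt; lra]).
    nra.
Qed.

(** The numerator of the derivative of U / (y H), which is minus the logarithmic
    derivative of H / y^(q+2); it is nonnegative where H / y^(q+2) is
    log-concave. *)
Definition log_concavity (q : nat) (y : R) : R :=
  y * wronskian q y - defect q y * sin_int2 q y.

Lemma log_concavity_eq q y :
  log_concavity q y + y ^ 2 * sin_int2 q y * sin y ^ q =
  (y * sin_int q y) ^ 2 - (INR q + 2) * sin_int2 q y ^ 2.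
Proof. unfold log_concavity, wronskian, defect, defect'. ring. Qed.

Lemma is_derive_log_concavity q y : (0 < q)%nat -> 0 < y < PI ->
  is_derive (log_concavity q) y
    (y * sin y ^ q * (cot_defect q y * sin_int2 q y - defect q y)
     - 2 * defect q y * sin_int q y).
Proof.
  intros Hq Hy.
  evar_last.
  - apply (is_derive_minus (fun y => y * wronskian q y)
             (fun y => defect q y * sin_int2 q y)).
    + apply (is_derive_mult (K := R_AbsRing) (fun y => y) (wronskian q)).
      * apply @is_derive_id.
      * apply is_derive_wronskian; assumption.
      * intros n m; apply Rmult_comm.
    + apply (is_derive_mult (K := R_AbsRing) (defect q) (sin_int2 q)).
      * apply is_derive_defect.
      * apply is_derive_sin_int2.
      * intros n m; apply Rmult_comm.
  - unfold minus, plus, opp, mult, one; simpl. unfold wronskian. ring.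
Qed.

(** Up to the positive factor y^3 sin^q, the derivative of
    (log_concavity) H / (y^2 sin^q).  The hypothesis says that X = y K is at
    least (q+1) H, and then the excess of d H over U given by
    [cot_defect_excess] outweighs the negative term. *)
Lemma log_concavity_barrier q y : (2 <= q)%nat -> 0 < y < PI ->
  defect q y <= sin_int2 q y ->
  0 <= (cot_defect q y * sin_int2 q y - defect q y)
        * ((y * sin_int q y) ^ 2 - (INR q + 2) * sin_int2 q y ^ 2)
       - 2 * defect q y * sin_int2 q y * (y * sin_int q y).
Proof.
  intros Hq Hy HU.
  pose proof (cot_defect_excess q y ltac:(lia) Hy) as H1.
  pose proof (defect_nonneg q y ltac:(lia) Hy) as H2.
  pose proof (sin_int2_pos q y ltac:(lra)) as H3.
  apply le_INR in Hq; simpl in Hq.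
  set (Q := INR q) in *. set (H := sin_int2 q y) in *. set (U := defect q y) in *.
  set (X := y * sin_int q y).
  assert (HX : X = (Q + 2) * H - U) by (unfold X, U, H, Q, defect; ring).
  assert (HX1 : (Q + 1) * H <= X) by (rewrite HX; lra).
  set (E := cot_defect q y * H - U) in *.
  assert (Hm : 2 * (Q + 1) * (Q + 2) * (X * H) <= (4 * Q + 10) * (X ^ 2 - (Q + 2) * H ^ 2)).
  { set (Z := X - (Q + 1) * H). assert (HZ : 0 <= Z) by (unfold Z; lra).
    replace X with ((Q + 1) * H + Z) by (unfold Z; ring).
    (* With X = (Q+1) H + Z the inequality is a quadratic form in H and Z with
       nonnegative coefficients; the coefficient of H^2 is where Q >= 2 enters. *)
    enough (0 <= (2 * Q ^ 3 + 6 * Q ^ 2 - 4 * Q - 14) * H ^ 2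
      + (2 * (4 * Q + 10) * (Q + 1) - 2 * (Q + 1) * (Q + 2)) * (H * Z)
      + (4 * Q + 10) * Z ^ 2) by lra.
    apply Rplus_le_le_0_compat; [apply Rplus_le_le_0_compat|];
      apply Rmult_le_pos; try nra. }
  assert (HN : 0 <= X ^ 2 - (Q + 2) * H ^ 2).
  { apply Rmult_le_reg_l with (4 * Q + 10); [lra|].
    assert (0 <= 2 * (Q + 1) * (Q + 2) * (X * H))
      by (apply Rmult_le_pos; [|apply Rmult_le_pos]; nra).
    lra. }
  set (N := X ^ 2 - (Q + 2) * H ^ 2) in *.
  assert (Hc : 0 < (Q + 2) * (Q + 1)) by nra.
  apply Rmult_le_reg_l with ((Q + 2) * (Q + 1)); [exact Hc|].
  assert (HA : (4 * Q + 10) * U * N <= (Q + 2) * (Q + 1) * E * N)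
    by (apply Rmult_le_compat_r; lra).
  assert (HB : U * (2 * (Q + 1) * (Q + 2) * (X * H)) <= U * ((4 * Q + 10) * N))
    by (apply Rmult_le_compat_l; lra).
  lra.
Qed.

(** The factor H / (y^2 sin^q) is the integrating factor that makes the
    derivative of [log_concavity] proportional to a quantity of known sign.
    Since U / H is nondecreasing, the hypothesis at y holds on all of (0, y]. *)
Lemma log_concavity_nonneg q y : (2 <= q)%nat -> 0 < y < PI -> defect q y <= sin_int2 q y ->
  0 <= log_concavity q y.
Proof.
  intros Hq Hy HU.
  assert (Hq0 : (0 < q)%nat) by lia.
  (* U / H is nondecreasing and at most 1 at y. *)
  assert (HU' : forall t, 0 < t <= y -> defect q t <= sin_int2 q t).
  { intros t Ht. pose proof (defect_ratio_mono q t y Hq0 Ht ltac:(lra)) as H1.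
    pose proof (sin_int2_pos q t ltac:(lra)) as H2.
    pose proof (sin_int2_pos q y ltac:(lra)) as H3.
    assert (H4 : defect q y / sin_int2 q y <= 1) by (apply Rle_div_l; lra).
    apply Rmult_le_reg_r with (/ sin_int2 q t); [apply Rinv_0_lt_compat; lra|].
    rewrite Rinv_r by lra. unfold Rdiv in *. lra. }
  pose proof (pos_INR q) as HQ.
  pose proof (sin_pow_pos q y Hy) as HS.
  pose proof (sin_int2_pos q y ltac:(lra)) as HH.
  enough (H0 : 0 <= log_concavity q y * sin_int2 q y / (y ^ 2 * sin y ^ q)).
  { assert (Hd : 0 < y ^ 2 * sin y ^ q) by (apply Rmult_lt_0_compat; [apply pow_lt|]; lra).
    apply Rmult_le_reg_r with (sin_int2 q y / (y ^ 2 * sin y ^ q)).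
    - apply Rdiv_lt_0_compat; lra.
    - rewrite Rmult_0_l. unfold Rdiv in *. rewrite <- Rmult_assoc. exact H0. }
  apply (nonneg_of_deriv_at_right
    (fun y => log_concavity q y * sin_int2 q y / (y ^ 2 * sin y ^ q))
    (fun y => ((cot_defect q y * sin_int2 q y - defect q y)
        * ((y * sin_int q y) ^ 2 - (INR q + 2) * sin_int2 q y ^ 2)
       - 2 * defect q y * sin_int2 q y * (y * sin_int q y)) / (y ^ 3 * sin y ^ q))
    (INR q + 3)); [lra| | |].
  - intros t Ht Ht1.
    pose proof (sin_pow_pos q t ltac:(lra)) as H1.
    pose proof (sin_pow_bounds q t ltac:(lra)) as H2.
    pose proof (sin_int2_pos q t ltac:(lra)) as H3.
    pose proof (sin_int2_le_id q t ltac:(lra)) as H4.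
    pose proof (sin_int2_le_near_0 q t ltac:(lra)) as H5.
    pose proof (log_concavity_eq q t) as H6.
    set (d := t ^ 2 * sin t ^ q) in *.
    assert (Hd : 0 < d) by (apply Rmult_lt_0_compat; [apply pow_lt|]; lra).
    replace (log_concavity q t * sin_int2 q t / d)
      with (log_concavity q t * (sin_int2 q t / d)) by (unfold Rdiv; ring).
    set (w := sin_int2 q t / d).
    assert (Hw : 0 <= w <= 1).
    { split; [apply Rdiv_le_0_compat; lra|apply Rle_div_l; lra]. }
    assert (Hd1 : d <= 1).
    { unfold d. simpl. rewrite Rmult_1_r.
      assert (0 <= t * t <= 1) by nra. nra. }
    assert (Hl : - ((INR q + 3) * t) <= log_concavity q t).
    { replace (t ^ 2 * sin_int2 q t * sin t ^ q) with (sin_int2 q t * d) in H6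
        by (unfold d; ring).
      assert (sin_int2 q t * d <= sin_int2 q t) by nra.
      assert (sin_int2 q t ^ 2 <= sin_int2 q t) by nra.
      pose proof (pow2_ge_0 (t * sin_int q t)).
      assert ((INR q + 2) * sin_int2 q t ^ 2 <= (INR q + 2) * t)
        by (apply Rmult_le_compat_l; lra).
      lra. }
    assert (0 <= (INR q + 3) * t) by (apply Rmult_le_pos; lra).
    nra.
  - intros t Ht.
    pose proof (sin_pow_pos q t ltac:(lra)) as H1.
    assert (Hd : 0 < t ^ 2 * sin t ^ q) by (apply Rmult_lt_0_compat; [apply pow_lt|]; lra).
    evar_last.
    + apply is_derive_div.
      * apply (is_derive_mult (K := R_AbsRing) (log_concavity q) (sin_int2 q));
          [apply is_derive_log_concavity; [exact Hq0|lra]|apply is_derive_sin_int2|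
           intros n m; apply Rmult_comm].
      * apply (is_derive_mult (K := R_AbsRing) (fun y => y ^ 2) (fun y => sin y ^ q));
          [apply (is_derive_pow (fun y => y) 2 t 1), @is_derive_id|
           apply is_derive_sin_pow|intros n m; apply Rmult_comm].
      * lra.
    + pose proof (sin_pow_logderiv q t Hq0 ltac:(lra)) as E1.
      rewrite <- log_concavity_eq.
      unfold plus, mult, Rdiv; simpl.
      assert (E2 : t * (INR q * cos t * sin t ^ pred q) =
        (INR q - cot_defect q t) * sin t ^ q) by lra.
      assert (E3 : INR q * cos t * sin t ^ pred q =
        (INR q - cot_defect q t) * sin t ^ q / t) by (rewrite <- E2; field; lra).
      rewrite E3.
      assert (E4 : sin_int q t = ((INR q + 2) * sin_int2 q t - defect q t) / t)
        by (unfold defect; field; lra).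
      rewrite E4. field; lra.
  - intros t Ht. apply Rdiv_le_0_compat.
    + apply log_concavity_barrier; [exact Hq|lra|apply HU'; lra].
    + apply Rmult_lt_0_compat; [apply pow_lt; lra|apply sin_pow_pos; lra].
Qed.

(** * Convexity of the multiplier *)

(** This quantity has the sign of the second derivative of [power_ratio].  If
    U > H it is a sum of two nonnegative terms; otherwise it is U^2 plus
    [log_concavity]. *)
Lemma convexity_numerator_nonneg q y : (2 <= q)%nat -> 0 < y < PI ->
  0 <= defect q y ^ 2 - defect q y * sin_int2 q y + y * wronskian q y.
Proof.
  intros Hq Hy.
  destruct (Rle_dec (defect q y) (sin_int2 q y)) as [H|H].
  - pose proof (log_concavity_nonneg q y Hq Hy H) as H1. unfold log_concavity in H1.
    pose proof (pow2_ge_0 (defect q y)). lra.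
  - pose proof (wronskian_nonneg q y ltac:(lia) Hy).
    pose proof (sin_int2_pos q y ltac:(lra)). nra.
Qed.

(** As a function of y = m h / 2, this is the symbol of the operator that maps
    W_{2k}(tau, ., h) to the derivative of tau of order q = 2k, up to a constant
    factor. *)
Definition power_ratio (q : nat) (y : R) : R := y ^ (q + 2) / sin_int2 q y.
Definition power_ratio' (q : nat) (y : R) : R :=
  y ^ (q + 1) * defect q y / sin_int2 q y ^ 2.

Lemma is_derive_power_ratio q y : 0 < y <= PI ->
  is_derive (power_ratio q) y (power_ratio' q y).
Proof.
  intros Hy. pose proof (sin_int2_pos q y Hy) as H1.
  evar_last.
  - apply is_derive_div; [|apply is_derive_sin_int2|lra].
    apply (is_derive_pow (fun y => y) (q + 2) y 1), @is_derive_id.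
  - unfold power_ratio', defect. rewrite plus_INR.
    replace (pred (q + 2)) with (q + 1)%nat by lia.
    rewrite !pow_add. simpl. field; lra.
Qed.

Lemma is_derive_power_ratio' q y : (0 < q)%nat -> 0 < y < PI ->
  is_derive (power_ratio' q) y
    (y ^ q * (defect q y ^ 2 - defect q y * sin_int2 q y + y * wronskian q y)
     / sin_int2 q y ^ 3).
Proof.
  intros Hq Hy. pose proof (sin_int2_pos q y ltac:(lra)) as H1.
  evar_last.
  - apply is_derive_div.
    + apply (is_derive_mult (K := R_AbsRing) (fun y => y ^ (q + 1)) (defect q)).
      * apply (is_derive_pow (fun y => y) (q + 1) y 1), @is_derive_id.
      * apply is_derive_defect.
      * intros n m; apply Rmult_comm.
    + apply (is_derive_pow (sin_int2 q) 2), is_derive_sin_int2.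
    + apply pow_nonzero; lra.
  - unfold plus, mult, wronskian; simpl. rewrite plus_INR.
    replace (pred (q + 1)) with q by lia.
    rewrite !pow_add. simpl.
    assert (E4 : sin_int q y = ((INR q + 2) * sin_int2 q y - defect q y) / y)
        by (unfold defect; field; lra).
    rewrite E4. field; lra.
Qed.

Lemma power_ratio'_nonneg q y : (0 < q)%nat -> 0 < y < PI -> 0 <= power_ratio' q y.
Proof.
  intros Hq Hy. pose proof (sin_int2_pos q y ltac:(lra)). unfold power_ratio'.
  apply Rdiv_le_0_compat; [apply Rmult_le_pos|apply pow_lt; lra].
  - apply pow_le; lra.
  - apply defect_nonneg; assumption.
Qed.

Lemma power_ratio'_mono q x y : (2 <= q)%nat -> 0 < x < y -> y < PI ->
  power_ratio' q x <= power_ratio' q y.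
Proof.
  intros Hq Hx Hy.
  destruct (MVT_cor2 (power_ratio' q)
    (fun y => y ^ q * (defect q y ^ 2 - defect q y * sin_int2 q y + y * wronskian q y)
              / sin_int2 q y ^ 3) x y ltac:(lra)) as [c [Hc1 Hc2]].
  - intros c Hc. apply is_derive_Reals, is_derive_power_ratio'; [lia|lra].
  - pose proof (sin_int2_pos q c ltac:(lra)).
    assert (0 <= c ^ q * (defect q c ^ 2 - defect q c * sin_int2 q c + c * wronskian q c)
              / sin_int2 q c ^ 3).
    { apply Rdiv_le_0_compat; [apply Rmult_le_pos|apply pow_lt; lra].
      - apply pow_le; lra.
      - apply convexity_numerator_nonneg; [exact Hq|lra]. }
    nra.
Qed.

Lemma power_ratio_mono q x y : (0 < q)%nat -> 0 < x < y -> y <= PI ->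
  power_ratio q x <= power_ratio q y.
Proof.
  intros Hq Hx Hy.
  destruct (MVT_cor2 (power_ratio q) (power_ratio' q) x y ltac:(lra)) as [c [Hc1 Hc2]].
  - intros c Hc. apply is_derive_Reals, is_derive_power_ratio; lra.
  - pose proof (power_ratio'_nonneg q c Hq ltac:(lra)). nra.
Qed.

Lemma power_ratio_convex q x y z : (2 <= q)%nat -> 0 < x < y -> z - y = y - x -> z <= PI ->
  2 * power_ratio q y <= power_ratio q x + power_ratio q z.
Proof.
  intros Hq Hx Hz Hpi.
  destruct (MVT_cor2 (power_ratio q) (power_ratio' q) x y ltac:(lra)) as [c [Hc1 Hc2]].
  - intros c Hc. apply is_derive_Reals, is_derive_power_ratio; lra.
  - destruct (MVT_cor2 (power_ratio q) (power_ratio' q) y z ltac:(lra)) as [d [Hd1 Hd2]].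
    + intros d Hd. apply is_derive_Reals, is_derive_power_ratio; lra.
    + pose proof (power_ratio'_mono q c d Hq ltac:(lra) ltac:(lra)). nra.
Qed.

(** * Finite sums of reals *)

Lemma sum_n_Rplus (u v : nat -> R) N :
  sum_n (fun i => u i + v i) N = sum_n u N + sum_n v N.
Proof. exact (sum_n_plus u v N). Qed.

Lemma sum_n_Rmult_l (c : R) (u : nat -> R) N :
  sum_n (fun i => c * u i) N = c * sum_n u N.
Proof. exact (sum_n_mult_l (K := R_Ring) c u N). Qed.

Lemma sum_n_S (u : nat -> R) N : sum_n u (S N) = sum_n u N + u (S N).
Proof. exact (sum_Sn u N). Qed.

Lemma sum_n_0 (u : nat -> R) : sum_n u 0 = u 0%nat.
Proof. exact (sum_O u). Qed.

Lemma sum_n_Rext (u v : nat -> R) N :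
  (forall i, (i <= N)%nat -> u i = v i) -> sum_n u N = sum_n v N.
Proof. intros H. apply (sum_n_ext_loc (G := R_AbelianMonoid)). exact H. Qed.

Lemma sum_n_Rswitch (u : nat -> nat -> R) N M :
  sum_n (fun i => sum_n (fun j => u i j) M) N =
  sum_n (fun j => sum_n (fun i => u i j) N) M.
Proof. exact (sum_n_switch u N M). Qed.

Lemma sum_n_le (u v : nat -> R) N :
  (forall i, (i <= N)%nat -> u i <= v i) -> sum_n u N <= sum_n v N.
Proof. intros H. rewrite !sum_n_Reals. apply sum_Rle; exact H. Qed.

Lemma sum_n_nonneg (u : nat -> R) N :
  (forall i, (i <= N)%nat -> 0 <= u i) -> 0 <= sum_n u N.
Proof.
  intros H. rewrite sum_n_Reals.
  induction N as [|N IH]; simpl; [apply H; lia|].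
  apply Rplus_le_le_0_compat; [apply IH; intros; apply H; lia|apply H; lia].
Qed.

Lemma sum_n_Rabs_le (u : nat -> R) N : Rabs (sum_n u N) <= sum_n (fun i => Rabs (u i)) N.
Proof. rewrite !sum_n_Reals. apply Rsum_abs. Qed.

Lemma sum_n_select (u : nat -> R) l N : (l <= N)%nat ->
  sum_n (fun m => if Nat.eqb m l then u m else 0) N = u l.
Proof.
  assert (H0 : forall M, (M < l)%nat ->
    sum_n (fun m => if Nat.eqb m l then u m else 0) M = 0).
  { induction M as [|M IH]; intros HM.
    - rewrite sum_n_0. destruct (Nat.eqb_spec 0 l); [lia|reflexivity].
    - rewrite sum_n_S, IH by lia. destruct (Nat.eqb_spec (S M) l); [lia|lra]. }
  induction N as [|N IH]; intros HN.
  - rewrite sum_n_0. destruct (Nat.eqb_spec 0 l); [subst; reflexivity|lia].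
  - rewrite sum_n_S. destruct (Nat.eqb_spec (S N) l) as [Hl|Hl].
    + rewrite H0, Hl by lia. apply Rplus_0_l.
    + rewrite IH by lia. apply Rplus_0_r.
Qed.

Lemma sum_n_const_R (c : R) N : sum_n (fun _ => c) N = INR (S N) * c.
Proof. exact (sum_n_const N c). Qed.

(** * Discrete cosine transform *)

Lemma sum_cos_telescope N th c :
  2 * sin (th / 2) * sum_n (fun s => cos (INR s * th + c)) N =
  sin (INR (S N) * th + (c - th / 2)) - sin (c - th / 2).
Proof.
  assert (E : forall s, 2 * sin (th / 2) * cos (INR s * th + c) =
    sin (INR (S s) * th + (c - th / 2)) - sin (INR s * th + (c - th / 2))).
  { intros s. rewrite S_INR.
    replace ((INR s + 1) * th + (c - th / 2)) with ((INR s * th + c) + th / 2) by field.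
    replace (INR s * th + (c - th / 2)) with ((INR s * th + c) - th / 2) by ring.
    rewrite sin_plus, sin_minus. ring. }
  induction N as [|N IH].
  - rewrite sum_n_0, E. simpl. rewrite Rmult_0_l, Rplus_0_l. ring.
  - rewrite sum_n_S, Rmult_plus_distr_l, IH, E. ring.
Qed.

(** The right-hand side of [sum_cos_telescope] compares two sines whose
    arguments differ by a whole number of turns. *)
Lemma sum_cos_full_turns N th c l m :
  sin (th / 2) <> 0 -> INR (S N) * th = 2 * INR l * PI - 2 * INR m * PI ->
  sum_n (fun s => cos (INR s * th + c)) N = 0.
Proof.
  intros Hs Hth. pose proof (sum_cos_telescope N th c) as H.
  rewrite Hth in H.
  replace (sin (2 * INR l * PI - 2 * INR m * PI + (c - th / 2))) with (sin (c - th / 2))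
    in H.
  - rewrite Rminus_diag in H. apply Rmult_integral in H. destruct H; [lra|assumption].
  - rewrite <- (sin_period (2 * INR l * PI - 2 * INR m * PI + (c - th / 2)) m).
    rewrite <- (sin_period (c - th / 2) l). f_equal. ring.
Qed.

(** On the 2n-periodic even extension, an interior index m stands for both m and
    -m, whereas 0 and n are their own opposites. *)
Definition cosine_weight (n m : nat) : R :=
  if orb (Nat.eqb m 0) (Nat.eqb m n) then 1 else 2.

Definition node (n s : nat) : R := INR s * (PI / INR n).

Lemma sum_cos_nodes n N (j : R) c : (0 < n)%nat -> S N = (2 * n)%nat ->
  forall l m : nat, j = INR l - INR m -> sin (j * PI / (2 * INR n)) <> 0 ->
  sum_n (fun s => cos (j * node n s + c)) N = 0.
Proof.
  intros Hn HN l m Hj Hs.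
  assert (Hn' : 0 < INR n) by (apply lt_0_INR; exact Hn).
  rewrite <- (sum_cos_full_turns N (j * (PI / INR n)) c l m).
  - apply sum_n_Rext; intros s _. f_equal. unfold node. ring.
  - replace (j * (PI / INR n) / 2) with (j * PI / (2 * INR n)) by (field; lra). exact Hs.
  - rewrite HN, mult_INR. simpl. rewrite Hj. field. lra.
Qed.

Lemma sin_frac_pos (x n : R) : 0 < x < 2 * n -> 0 < sin (x * PI / (2 * n)).
Proof.
  intros Hx. pose proof PI_RGT_0. apply sin_gt_0.
  - apply Rdiv_lt_0_compat; [apply Rmult_lt_0_compat|]; lra.
  - apply Rlt_div_l; [lra|]. nra.
Qed.

(** Splitting the product of cosines gives sums of the frequencies l + m and
    l - m.  Both vanish unless the frequency is a multiple of 2n, which happens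
    for l - m when l = m and for l + m when l = m is an endpoint.  The phase c
    lets one statement serve both cosine and sine. *)
Lemma dct_orthogonality n N l m c : (0 < n)%nat -> S N = (2 * n)%nat ->
  (l <= n)%nat -> (m <= n)%nat ->
  cosine_weight n m *
    sum_n (fun s => cos (INR m * node n s) * cos (INR l * node n s + c)) N =
  if Nat.eqb m l then 2 * INR n * cos c else 0.
Proof.
  intros Hn HN Hl Hm. pose proof PI_RGT_0 as HPI.
  assert (Hn' : 0 < INR n) by (apply lt_0_INR; exact Hn).
  assert (E : sum_n (fun s => cos (INR m * node n s) * cos (INR l * node n s + c)) N =
    / 2 * (sum_n (fun s => cos ((INR l + INR m) * node n s + c)) N
       + sum_n (fun s => cos ((INR l - INR m) * node n s + c)) N)).
  { rewrite <- sum_n_Rplus, <- sum_n_Rmult_l. apply sum_n_Rext; intros s _.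
    replace ((INR l + INR m) * node n s + c)
      with ((INR l * node n s + c) + INR m * node n s) by ring.
    replace ((INR l - INR m) * node n s + c)
      with ((INR l * node n s + c) - INR m * node n s) by ring.
    generalize (INR l * node n s + c) (INR m * node n s); intros u v.
    rewrite cos_plus, cos_minus. field. }
  rewrite E. clear E.
  assert (Hplus : (0 < l + m < 2 * n)%nat ->
    sum_n (fun s => cos ((INR l + INR m) * node n s + c)) N = 0).
  { intros H. apply (sum_cos_nodes n N (INR l + INR m) c Hn HN (l + m) 0).
    - rewrite plus_INR; simpl; ring.
    - apply Rgt_not_eq, sin_frac_pos.
      destruct H as [H1 H2]. apply lt_INR in H1, H2.
      rewrite plus_INR in H1, H2. rewrite mult_INR in H2. simpl in H1, H2. lra. }
  assert (Hcst : forall j : R,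
    (forall s, cos (j * node n s + c) = cos c) ->
    sum_n (fun s => cos (j * node n s + c)) N = 2 * INR n * cos c).
  { intros j Hj. rewrite (sum_n_Rext _ (fun _ => cos c)) by (intros; apply Hj).
    rewrite sum_n_const_R, HN, mult_INR. simpl. ring. }
  destruct (Nat.eqb_spec m l) as [->|Hne].
  - rewrite (Hcst (INR l - INR l)).
    2:{ intros s. f_equal. ring. }
    unfold cosine_weight.
    destruct (Nat.eqb_spec l 0) as [->|H0]; [|destruct (Nat.eqb_spec l n) as [->|H1]];
      simpl orb.
    + rewrite (Hcst (INR 0 + INR 0)); [field|].
      intros s. f_equal. simpl. ring.
    + rewrite (Hcst (INR n + INR n)); [field|].
      intros s. rewrite <- (cos_period c s). f_equal. unfold node. field. lra.
    + rewrite Hplus by lia. field.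
  - rewrite Hplus by lia.
    rewrite (sum_cos_nodes n N (INR l - INR m) c Hn HN l m); [ring|reflexivity|].
    destruct (Nat.lt_gt_cases l m) as [[H|H] _]; [congruence| |].
    + replace ((INR l - INR m) * PI / (2 * INR n))
        with (- ((INR m - INR l) * PI / (2 * INR n))) by (field; lra).
      rewrite sin_neg. apply Ropp_neq_0_compat, Rgt_not_eq, sin_frac_pos.
      apply lt_INR in H. apply le_INR in Hm. pose proof (pos_INR l). lra.
    + apply Rgt_not_eq, sin_frac_pos.
      apply lt_INR in H. apply le_INR in Hl. pose proof (pos_INR m). lra.
Qed.

Definition dct (n : nat) (e : nat -> R) (s : nat) : R :=
  sum_n (fun m => cosine_weight n m * e m * cos (INR m * node n s)) n.

Lemma dct_inversion n N e l c : (0 < n)%nat -> S N = (2 * n)%nat -> (l <= n)%nat ->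
  sum_n (fun s => dct n e s * cos (INR l * node n s + c)) N = 2 * INR n * e l * cos c :> R.
Proof.
  intros Hn HN Hl.
  rewrite (sum_n_Rext _ (fun s => sum_n (fun m => e m * (cosine_weight n m *
     (cos (INR m * node n s) * cos (INR l * node n s + c)))) n)).
  2:{ intros s _. unfold dct. rewrite Rmult_comm, <- sum_n_Rmult_l.
      apply sum_n_Rext; intros m _. ring. }
  rewrite sum_n_Rswitch.
  rewrite (sum_n_Rext _ (fun m => if Nat.eqb m l then e m * (2 * INR n * cos c) else 0)).
  - etransitivity; [exact (sum_n_select (fun m => e m * (2 * INR n * cos c)) l n Hl)|ring].
  - intros m Hm. rewrite !sum_n_Rmult_l.
    rewrite dct_orthogonality by assumption.
    destruct (Nat.eqb m l); ring.
Qed.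

(** * Coefficients of convex sequences *)

(** As pred 0 = 0, the value at 0 is e 1 - e 0, which is half of the second
    difference there of the even extension. *)
Definition second_diff (e : nat -> R) (m : nat) : R := e (S m) - 2 * e m + e (pred m).

(** Two summations by parts: 2 - 2 cos th is the symbol of minus the second
    difference. *)
Lemma abel_cos (e : nat -> R) th N :
  (2 - 2 * cos th) *
    sum_n (fun m => (if Nat.eqb m 0 then 1 else 2) * e m * cos (INR m * th)) N =
  - (2 * sum_n (fun m => second_diff e m * cos (INR m * th)) N)
  + 2 * e (S N) * cos (INR N * th) - 2 * e N * cos (INR (S N) * th).
Proof.
  induction N as [|N IH].
  - rewrite !sum_n_0. unfold second_diff. simpl.
    replace (0 * th) with 0 by ring. replace (1 * th) with th by ring.
    rewrite cos_0. ring.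
  - rewrite !sum_n_S. rewrite !Rmult_plus_distr_l, IH.
    unfold second_diff. simpl Nat.eqb. simpl pred. cbv iota.
    rewrite !(S_INR (S N)).
    replace (INR N * th) with (INR (S N) * th - th) by (rewrite S_INR; ring).
    replace ((INR (S N) + 1) * th) with (INR (S N) * th + th) by ring.
    rewrite cos_plus, cos_minus. ring.
Qed.

Lemma sum_second_diff (e : nat -> R) N : sum_n (second_diff e) N = e (S N) - e N :> R.
Proof.
  induction N as [|N IH].
  - rewrite sum_n_0. unfold second_diff. simpl. ring.
  - rewrite sum_n_S, IH. unfold second_diff. simpl. ring.
Qed.

(** The second differences of the 2n-periodic even extension add up to 0, so the
    one at n, the only one that may be negative when e is convex, can be
    eliminated.  This turns each cosine into 1 - cos(m th) cos(n th), and
    cos(n th) = (-1)^s. *)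
Lemma dct_abel n e s : (0 < n)%nat ->
  (2 - 2 * cos (node n s)) * (dct n e s * cos (INR n * node n s)) =
  2 * sum_n (fun m => second_diff e m *
        (1 - cos (INR m * node n s) * cos (INR n * node n s))) (pred n).
Proof.
  intros Hn. destruct n as [|n]; [lia|]. simpl pred.
  set (th := node (S n) s).
  assert (Hs : sin (INR (S n) * th) = 0).
  { unfold th, node. apply sin_eq_0_1. exists (Z.of_nat s). rewrite <- INR_IZR_INZ.
    field. apply not_0_INR; lia. }
  assert (Hc : cos (INR (S n) * th) * cos (INR (S n) * th) = 1).
  { pose proof (sin2_cos2 (INR (S n) * th)) as H. unfold Rsqr in H. rewrite Hs in H. lra. }
  set (sg := cos (INR (S n) * th)) in *.
  assert (Hc' : cos (INR n * th) = sg * cos th).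
  { replace (INR n * th) with (INR (S n) * th - th) by (rewrite S_INR; ring).
    rewrite cos_minus, Hs. fold sg. ring. }
  assert (Hd : dct (S n) e s =
    sum_n (fun m => (if Nat.eqb m 0 then 1 else 2) * e m * cos (INR m * th)) n
    + e (S n) * sg).
  { unfold dct. rewrite sum_n_S. f_equal.
    - apply sum_n_Rext; intros m Hm. unfold cosine_weight.
      destruct (Nat.eqb_spec m (S n)); [lia|]. rewrite Bool.orb_false_r. reflexivity.
    - unfold cosine_weight. rewrite Nat.eqb_refl, Bool.orb_true_r. fold th sg. ring. }
  pose proof (abel_cos e th n) as HA. fold sg in HA. rewrite Hc' in HA.
  rewrite (sum_n_Rext _ (fun m =>
      second_diff e m + (- sg) * (second_diff e m * cos (INR m * th)))) by (intros m _; ring).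
  rewrite sum_n_Rplus, sum_n_Rmult_l, (sum_second_diff e n).
  rewrite Hd.
  set (P := sum_n (fun m =>
    (if Nat.eqb m 0 then 1 else 2) * e m * cos (INR m * th)) n) in *.
  set (D := sum_n (fun m => second_diff e m * cos (INR m * th)) n) in *.
  replace ((2 - 2 * cos th) * ((P + e (S n) * sg) * sg))
    with (((2 - 2 * cos th) * P) * sg + (2 - 2 * cos th) * e (S n) * (sg * sg)) by ring.
  rewrite HA, Hc.
  replace ((- (2 * D) + 2 * e (S n) * (sg * cos th) - 2 * e n * sg) * sg)
    with (- (2 * D * sg) + (2 * e (S n) * cos th - 2 * e n) * (sg * sg)) by ring.
  rewrite Hc. ring.
Qed.

Lemma dct_alternates n e s : (0 < n)%nat -> (s < 2 * n)%nat ->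
  (forall m, (m <= n)%nat -> 0 <= e m) ->
  (forall m, (m < n)%nat -> 0 <= second_diff e m) ->
  0 <= dct n e s * cos (INR n * node n s).
Proof.
  intros Hn Hs He Hd.
  assert (Hn' : 0 < INR n) by (apply lt_0_INR; exact Hn).
  destruct s as [|s].
  - assert (H0 : node n 0 = 0) by (unfold node; simpl; ring).
    rewrite H0, Rmult_0_r, cos_0, Rmult_1_r. unfold dct.
    apply sum_n_nonneg. intros m Hm. rewrite H0, Rmult_0_r, cos_0, Rmult_1_r.
    apply Rmult_le_pos; [|apply He; exact Hm].
    unfold cosine_weight; destruct (orb _ _); lra.
  - set (th := node n (S s)). fold th.
    assert (Hth : 0 < th / 2 < PI).
    { unfold th, node. apply lt_INR in Hs. rewrite mult_INR in Hs.
      pose proof PI_RGT_0 as HPI. pose proof (lt_0_INR (S s) ltac:(lia)).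
      replace (INR (S s) * (PI / INR n) / 2) with (INR (S s) * PI / (2 * INR n))
        by (field; lra).
      split; [apply Rdiv_lt_0_compat; [apply Rmult_lt_0_compat|]; lra|].
      apply Rlt_div_l; [lra|]. change (INR 2) with (1 + 1) in Hs. nra. }
    assert (Hp : 0 < 2 - 2 * cos th).
    { replace th with (2 * (th / 2)) by field. rewrite cos_2a_sin.
      pose proof (sin_gt_0 (th / 2) ltac:(lra) ltac:(lra)). nra. }
    apply Rmult_le_reg_l with (2 - 2 * cos th); [exact Hp|].
    rewrite Rmult_0_r. unfold th. rewrite dct_abel by exact Hn. fold th.
    apply Rmult_le_pos; [lra|]. apply sum_n_nonneg. intros m Hm.
    apply Rmult_le_pos; [apply Hd; lia|].
    pose proof (COS_bound (INR m * th)). pose proof (COS_bound (INR n * th)). nra.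
Qed.

(** * Norms of convex multipliers *)

Definition trig_sum (n : nat) (a b : nat -> R) (x : R) : R :=
  sum_n (fun j => a j * cos (INR j * x) + b j * sin (INR j * x)) n.

(** By [dct_inversion], the multiplier e is a combination of translations by the
    nodes. *)
Lemma trig_sum_dct n N e a b x : (0 < n)%nat -> S N = (2 * n)%nat ->
  sum_n (fun s => dct n e s * trig_sum n a b (x + node n s)) N =
  2 * INR n * trig_sum n (fun j => e j * a j) (fun j => e j * b j) x :> R.
Proof.
  intros Hn HN. unfold trig_sum.
  rewrite (sum_n_Rext _ (fun s => sum_n (fun j =>
      a j * (dct n e s * cos (INR j * node n s + INR j * x))
    + b j * (dct n e s * cos (INR j * node n s + (INR j * x - PI / 2)))) n)).
  2:{ intros s _. rewrite <- sum_n_Rmult_l. apply sum_n_Rext; intros j _.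
      replace (INR j * (x + node n s)) with (INR j * node n s + INR j * x) by ring.
      rewrite (sin_cos (INR j * node n s + INR j * x)).
      replace (INR j * node n s + (INR j * x - PI / 2))
        with (- (PI / 2 - (INR j * node n s + INR j * x))) by ring.
      rewrite cos_neg, cos_shift.
      rewrite <- sin_cos. ring. }
  rewrite sum_n_Rswitch, <- sum_n_Rmult_l. apply sum_n_Rext; intros j Hj.
  rewrite sum_n_Rplus, !sum_n_Rmult_l, !(dct_inversion n N e j _ Hn HN Hj).
  replace (INR j * x - PI / 2) with (- (PI / 2 - INR j * x)) by ring.
  rewrite cos_neg, cos_shift. ring.
Qed.

(** The coefficients of the translations alternate in sign, so the sum of their
    absolute values is their transform at n, that is e n. *)
Lemma convex_multiplier_bound n e a b B : (0 < n)%nat ->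
  (forall m, (m <= n)%nat -> 0 <= e m) ->
  (forall m, (m < n)%nat -> 0 <= second_diff e m) ->
  (forall x, Rabs (trig_sum n a b x) <= B) ->
  forall x, Rabs (trig_sum n (fun j => e j * a j) (fun j => e j * b j) x) <= e n * B.
Proof.
  intros Hn He Hd HB x.
  assert (Hn' : 0 < INR n) by (apply lt_0_INR; exact Hn).
  destruct (Nat.lt_exists_pred 0 (2 * n) ltac:(lia)) as [N [HN _]]. symmetry in HN.
  apply Rmult_le_reg_l with (2 * INR n); [lra|].
  rewrite <- (Rabs_pos_eq (2 * INR n)) at 1 by lra.
  rewrite <- Rabs_mult, <- (trig_sum_dct n N) by assumption.
  eapply Rle_trans; [apply sum_n_Rabs_le|].
  apply Rle_trans with
    (sum_n (fun s => B * (dct n e s * cos (INR n * node n s + 0))) N).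
  - apply sum_n_le. intros s Hs. rewrite Rabs_mult, Rplus_0_r.
    pose proof (dct_alternates n e s Hn ltac:(lia) He Hd) as H.
    rewrite (Rmult_comm B).
    apply Rmult_le_compat; [apply Rabs_pos|apply Rabs_pos| |apply HB].
    rewrite <- (Rabs_pos_eq _ H), Rabs_mult.
    replace (Rabs (cos (INR n * node n s))) with 1; [lra|].
    assert (Hsin : sin (INR n * node n s) = 0).
    { unfold node. apply sin_eq_0_1. exists (Z.of_nat s). rewrite <- INR_IZR_INZ.
      field; lra. }
    pose proof (sin2_cos2 (INR n * node n s)) as E. rewrite Hsin in E.
    rewrite Rsqr_0, Rplus_0_l in E.
    rewrite <- sqrt_Rsqr_abs, E. symmetry; apply sqrt_1.
  - rewrite sum_n_Rmult_l, (dct_inversion n N e n 0 Hn HN (le_n n)), cos_0. lra.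
Qed.

(** * Central differences of cosines *)

Lemma Binomial_C_0 N : Binomial.C N 0 = 1.
Proof.
  unfold Binomial.C. rewrite Nat.sub_0_r. simpl. field. apply INR_fact_neq_0.
Qed.

Lemma Binomial_C_diag N : Binomial.C N N = 1.
Proof.
  unfold Binomial.C. rewrite Nat.sub_diag. simpl. field. apply INR_fact_neq_0.
Qed.

Lemma Binomial_C_pos N i : 0 < Binomial.C N i.
Proof.
  unfold Binomial.C. apply Rdiv_lt_0_compat; [apply INR_fact_lt_0|].
  apply Rmult_lt_0_compat; apply INR_fact_lt_0.
Qed.

Definition alt_diff (N : nat) (g : nat -> R) : R :=
  sum_n (fun i => (-1) ^ i * Binomial.C N i * g i) N.

(** Pascal's rule, followed by a shift of the index. *)
Lemma alt_diff_S N g : alt_diff (S N) g = alt_diff N (fun i => g i - g (S i)).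
Proof.
  assert (H : forall M, (M <= N)%nat ->
    sum_n (fun i => (-1) ^ i * Binomial.C (S N) i * g i) M =
    sum_n (fun i => (-1) ^ i * Binomial.C N i * (g i - g (S i))) M
    + (-1) ^ M * Binomial.C N M * g (S M)).
  { induction M as [|M IH]; intros HM.
    - rewrite !sum_n_0, !Binomial_C_0. simpl. ring.
    - rewrite !sum_n_S, IH, <- (pascal N M) by lia. simpl. ring. }
  unfold alt_diff. rewrite sum_n_S, H by lia. rewrite !Binomial_C_diag. simpl. ring.
Qed.

(** One difference turns cos u into 2 sin(th/2) cos(u + (th - PI)/2). *)
Lemma alt_diff_cos N th c :
  alt_diff N (fun i => cos (c + INR i * th)) =
  (2 * sin (th / 2)) ^ N * cos (c + INR N * ((th - PI) / 2)).
Proof.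
  revert c. induction N as [|N IH]; intros c.
  - unfold alt_diff. rewrite sum_n_0, Binomial_C_0. simpl.
    rewrite !Rmult_0_l. ring.
  - rewrite alt_diff_S.
    replace (c + INR (S N) * ((th - PI) / 2))
      with ((c + (th - PI) / 2) + INR N * ((th - PI) / 2)) by (rewrite S_INR; ring).
    simpl pow. rewrite Rmult_assoc, <- IH.
    unfold alt_diff. rewrite <- sum_n_Rmult_l. apply sum_n_Rext; intros i _.
    replace (c + INR (S i) * th) with ((c + INR i * th + th / 2) + th / 2)
      by (rewrite S_INR; field).
    replace (c + INR i * th) with ((c + INR i * th + th / 2) - th / 2) at 1 by field.
    replace (c + (th - PI) / 2 + INR i * th) with (- (PI / 2 - (c + INR i * th + th / 2)))
      by field.
    rewrite cos_neg, cos_shift.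
    generalize (c + INR i * th + th / 2); intros u.
    rewrite cos_plus, cos_minus. ring.
Qed.

Lemma pow_m1_sqr k : (-1) ^ k * (-1) ^ k = 1.
Proof.
  rewrite <- Rpow_mult_distr. replace (-1 * -1) with 1 by ring. apply pow1.
Qed.

Lemma powerRZ_m1_sub i k :
  powerRZ (-1) (Z.of_nat i - Z.of_nat k) = (-1) ^ k * (-1) ^ i.
Proof.
  unfold Z.sub. rewrite powerRZ_add by lra.
  rewrite powerRZ_neg', <- !pow_powerRZ.
  pose proof (pow_m1_sqr k) as E.
  assert ((-1) ^ k <> 0) by (apply pow_nonzero; lra).
  replace (/ (-1) ^ k) with ((-1) ^ k); [ring|].
  apply Rmult_eq_reg_l with ((-1) ^ k); [|assumption]. rewrite Rinv_r; assumption.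
Qed.

Lemma cos_sub_nPI k u : cos (u - INR k * PI) = (-1) ^ k * cos u.
Proof.
  induction k as [|k IH].
  - simpl. rewrite Rmult_0_l, Rminus_0_r. ring.
  - rewrite S_INR. replace (u - (INR k + 1) * PI) with ((u - INR k * PI) - PI) by ring.
    rewrite cos_minus, cos_PI, sin_PI, IH. simpl. ring.
Qed.

(** A central difference of even order is symmetric, so the phase produced by
    [alt_diff_cos] is k PI, which the signs (-1)^j absorb. *)
Lemma central_diff_cos k t m c x :
  central_diff k t (fun y => cos (m * y + c)) x =
  (2 * sin (m * t / 2)) ^ (2 * k) * cos (m * x + c).
Proof.
  unfold central_diff. cbv zeta.
  rewrite (sum_n_Rext _ (fun i => (-1) ^ k * ((-1) ^ i * Binomial.C (2 * k) i *
     cos ((m * x + c - INR k * (m * t)) + INR i * (m * t))))).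
  2:{ intros i _. rewrite powerRZ_m1_sub, minus_IZR, <- !INR_IZR_INZ.
      replace (m * (x + (INR i - INR k) * t) + c)
        with (m * x + c - INR k * (m * t) + INR i * (m * t)) by ring. ring. }
  rewrite sum_n_Rmult_l.
  change (sum_n _ (2 * k)) with
    (alt_diff (2 * k) (fun i => cos ((m * x + c - INR k * (m * t)) + INR i * (m * t)))).
  rewrite alt_diff_cos, mult_INR. change (INR 2) with 2.
  replace (m * x + c - INR k * (m * t) + 2 * INR k * ((m * t - PI) / 2))
    with (m * x + c - INR k * PI) by field.
  rewrite cos_sub_nPI.
  pose proof (pow_m1_sqr k) as E.
  replace ((-1) ^ k * ((2 * sin (m * t / 2)) ^ (2 * k) * ((-1) ^ k * cos (m * x + c))))
   with (((-1) ^ k * (-1) ^ k) * ((2 * sin (m * t / 2)) ^ (2 * k) * cos (m * x + c)))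
     by ring.
  rewrite E. ring.
Qed.

Lemma sin_as_cos u : sin u = cos (u + - (PI / 2)).
Proof.
  replace (u + - (PI / 2)) with (- (PI / 2 - u)) by ring.
  rewrite cos_neg, cos_shift. reflexivity.
Qed.

Lemma central_diff_trig_sum k t n a b x :
  central_diff k t (trig_sum n a b) x =
  trig_sum n (fun j => (2 * sin (INR j * t / 2)) ^ (2 * k) * a j)
             (fun j => (2 * sin (INR j * t / 2)) ^ (2 * k) * b j) x.
Proof.
  transitivity (sum_n (fun j =>
      a j * central_diff k t (fun y => cos (INR j * y + 0)) x
    + b j * central_diff k t (fun y => cos (INR j * y + - (PI / 2))) x) n).
  - unfold central_diff at 1. cbv zeta. unfold trig_sum.
    rewrite (sum_n_Rext _ (fun i => sum_n (fun j =>
       powerRZ (-1) (Z.of_nat i - Z.of_nat k) * Binomial.C (2 * k) i *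
       (a j * cos (INR j * (x + IZR (Z.of_nat i - Z.of_nat k) * t)) +
        b j * sin (INR j * (x + IZR (Z.of_nat i - Z.of_nat k) * t)))) n)).
    2:{ intros i _. symmetry. apply sum_n_Rmult_l. }
    rewrite sum_n_Rswitch. apply sum_n_Rext; intros j _.
    unfold central_diff. cbv zeta.
    rewrite <- !sum_n_Rmult_l, <- sum_n_Rplus. apply sum_n_Rext; intros i _.
    rewrite sin_as_cos, Rplus_0_r. ring.
  - unfold trig_sum. apply sum_n_Rext; intros j _.
    rewrite !central_diff_cos, <- sin_as_cos, Rplus_0_r. ring.
Qed.

(** * Integration against the triangular kernel *)

(** The triangle is the second primitive of a combination of point masses, so
    integrating a function against it gives values of the second primitive of
    that function.  At m = 0 the formula is a formal 0 / 0. *)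
Definition kernel_integral (k : nat) (h m : R) : R :=
  2 * 2 ^ (2 * k) * sin_int2 (2 * k) (m * h / 2) / (m * h / 2) ^ 2.

Lemma is_RInt_Rext (f g : R -> R) a b v : a <= b ->
  (forall x, a < x < b -> f x = g x) -> is_RInt f a b v -> is_RInt g a b v.
Proof.
  intros Hab H. apply (is_RInt_ext (V := R_NormedModule)).
  rewrite Rmin_left, Rmax_right by exact Hab. exact H.
Qed.

Lemma is_RInt_0 a b : is_RInt (fun _ : R => 0) a b 0.
Proof.
  pose proof (is_RInt_const (V := R_NormedModule) a b 0) as H.
  change (scal (b - a) 0) with ((b - a) * 0) in H. rewrite Rmult_0_r in H. exact H.
Qed.

Lemma is_RInt_even (f : R -> R) b v :
  (forall x, f (- x) = f x) -> is_RInt f 0 b v -> is_RInt f (- b) b (v + v).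
Proof.
  intros Hf Hv. apply (is_RInt_Chasles f (- b) 0 b v v); [|exact Hv].
  replace v with (- - v) by apply Ropp_involutive.
  apply (is_RInt_ext (V := R_NormedModule) (fun y => - - f (- y))).
  { intros x _. rewrite Ropp_involutive. apply Hf. }
  apply (is_RInt_opp (V := R_NormedModule) (fun y => - f (- y)) (- b) 0 (- v)).
  apply (is_RInt_swap (V := R_NormedModule)).
  apply (is_RInt_comp_opp (V := R_NormedModule) f 0 (- b)).
  rewrite Ropp_0, Ropp_involutive. exact Hv.
Qed.

Lemma is_RInt_kernel k h m : 0 < h < PI -> 0 < m ->
  is_RInt (fun t => (2 * sin (m * t / 2)) ^ (2 * k) * phi h t) (- PI) PI
    (kernel_integral k h m).
Proof.
  intros Hh Hm.
  set (v := 2 ^ (2 * k) * sin_int2 (2 * k) (m * h / 2) / (m * h / 2) ^ 2).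
  replace (kernel_integral k h m) with (v + v) by (unfold kernel_integral, v; field; lra).
  apply is_RInt_even.
  { intros t. unfold phi. rewrite Rabs_Ropp.
    replace (m * - t / 2) with (- (m * t / 2)) by field.
    rewrite sin_neg, !pow_mult. f_equal. f_equal. ring. }
  replace v with (plus v 0) by apply Rplus_0_r.
  apply (is_RInt_Chasles (V := R_NormedModule)) with h.
  - apply is_RInt_Rext with
      (fun t => 2 ^ (2 * k) * (sin (m * t / 2) ^ (2 * k) * (/ h * (1 - t / h)))).
    { lra. }
    { intros t Ht. unfold phi. rewrite Rabs_pos_eq by lra.
      destruct (Rle_dec t h); [|lra]. rewrite Rpow_mult_distr. ring. }
    (* Integration by parts against the linear factor h - t of the kernel. *)
    set (F := fun t => 2 ^ (2 * k) * (/ h ^ 2 *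
      ((h - t) * (2 / m) * sin_int (2 * k) (m * t / 2)
        + (2 / m) ^ 2 * sin_int2 (2 * k) (m * t / 2)))).
    replace v with (minus (F h) (F 0)).
    + apply (is_RInt_derive (V := R_CompleteNormedModule) F).
      * intros t _. unfold F. generalize (2 * k)%nat; intros q.
        generalize (2 ^ q); intros c.
        derive_sin_int q. change (m * t * / 2) with (m * t / 2). field; lra.
      * intros t _. apply (ex_derive_continuous (V := R_NormedModule)).
        auto_derive. easy.
    + change (F h - F 0 = v). unfold F, v.
      replace (m * 0 / 2) with 0 by field. rewrite sin_int_0, sin_int2_0.
      field; lra.
  - apply is_RInt_Rext with (fun _ => 0).
    { lra. }
    { intros t Ht. unfold phi. rewrite Rabs_pos_eq by lra.
      destruct (Rle_dec t h); [lra|ring]. }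
    apply is_RInt_0.
Qed.

(** The factor by which W_{2k}(., h) multiplies the frequency j. *)
Definition freq_mult (k : nat) (h : R) (j : nat) : R :=
  / Binomial.C (2 * k) k * (if Nat.eqb j 0 then 0 else kernel_integral k h (INR j)).

Lemma is_RInt_sum_n (f : nat -> R -> R) (v : nat -> R) a b N : a <= b ->
  (forall j, is_RInt (f j) a b (v j)) ->
  is_RInt (fun t => sum_n (fun j => f j t) N) a b (sum_n v N).
Proof.
  intros Hab H. induction N as [|N IH].
  - rewrite sum_n_0. apply is_RInt_Rext with (f 0%nat); [exact Hab| |apply H].
    intros t _. rewrite sum_n_0. reflexivity.
  - rewrite sum_n_S.
    apply is_RInt_Rext with (fun t => plus (sum_n (fun j => f j t) N) (f (S N) t)).
    { exact Hab. }
    { intros t _. rewrite sum_n_S. reflexivity. }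
    apply (is_RInt_plus (V := R_NormedModule)); [exact IH|apply H].
Qed.

Lemma W_at_trig_sum k n a b h x : (0 < k)%nat -> 0 < h < PI ->
  W_at k (trig_sum n a b) x h =
  trig_sum n (fun j => freq_mult k h j * a j) (fun j => freq_mult k h j * b j) x.
Proof.
  intros Hk Hh. unfold W_at.
  set (lam := fun j => if Nat.eqb j 0 then 0 else kernel_integral k h (INR j)).
  assert (Hlam : forall j, is_RInt
    (fun t => (2 * sin (INR j * t / 2)) ^ (2 * k) * phi h t) (- PI) PI (lam j)).
  { intros j. unfold lam. destruct (Nat.eqb_spec j 0) as [->|Hj].
    - apply is_RInt_Rext with (fun _ => 0); [pose proof PI_RGT_0; lra| |apply is_RInt_0].
      intros t _. simpl INR. replace (0 * t / 2) with 0 by field.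
      rewrite sin_0, Rmult_0_r, pow_ne_zero by lia. ring.
    - apply is_RInt_kernel; [exact Hh|]. apply lt_0_INR; lia. }
  rewrite (is_RInt_unique _ _ _ (sum_n (fun j =>
      (a j * cos (INR j * x) + b j * sin (INR j * x)) * lam j) n)).
  - unfold trig_sum. rewrite <- sum_n_Rmult_l. apply sum_n_Rext; intros j _.
    unfold freq_mult. fold (lam j). ring.
  - apply is_RInt_Rext with (fun t => sum_n (fun j =>
      (a j * cos (INR j * x) + b j * sin (INR j * x)) *
      ((2 * sin (INR j * t / 2)) ^ (2 * k) * phi h t)) n).
    { pose proof PI_RGT_0; lra. }
    { intros t _. rewrite central_diff_trig_sum. unfold trig_sum.
      rewrite Rmult_comm, <- sum_n_Rmult_l. apply sum_n_Rext; intros j _. ring. }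
    apply (is_RInt_sum_n (fun j t => (a j * cos (INR j * x) + b j * sin (INR j * x)) *
      ((2 * sin (INR j * t / 2)) ^ (2 * k) * phi h t))
      (fun j => (a j * cos (INR j * x) + b j * sin (INR j * x)) * lam j));
        [pose proof PI_RGT_0; lra|].
    intros j. apply (is_RInt_scal (V := R_NormedModule)). apply Hlam.
Qed.

(** * Derivatives and norms of trigonometric sums *)

Lemma is_derive_trig_sum n a b x :
  is_derive (trig_sum n a b) x
    (trig_sum n (fun j => INR j * b j) (fun j => - (INR j * a j)) x).
Proof.
  unfold trig_sum. induction n as [|n IH].
  - rewrite sum_n_0.
    apply is_derive_ext with
      (fun x => a 0%nat * cos (INR 0 * x) + b 0%nat * sin (INR 0 * x)).
    { intros t. rewrite sum_n_0. reflexivity. }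
    auto_derive; [easy|]. simpl. ring.
  - rewrite sum_n_S.
    apply is_derive_ext with (fun x => plus
      (sum_n (fun j => a j * cos (INR j * x) + b j * sin (INR j * x)) n)
      (a (S n) * cos (INR (S n) * x) + b (S n) * sin (INR (S n) * x))).
    { intros t. rewrite sum_n_S. reflexivity. }
    apply (is_derive_plus (V := R_NormedModule)); [exact IH|].
    generalize (INR (S n)); intros r. auto_derive; [easy|]. ring.
Qed.

Lemma Derive_trig_sum n a b :
  Derive (trig_sum n a b) = trig_sum n (fun j => INR j * b j) (fun j => - (INR j * a j)).
Proof.
  apply functional_extensionality; intros x. apply is_derive_unique, is_derive_trig_sum.
Qed.

Lemma Derive_n_trig_sum n a b k x :
  Derive_n (trig_sum n a b) (2 * k) x =
  (-1) ^ k * trig_sum n (fun j => INR j ^ (2 * k) * a j) (fun j => INR j ^ (2 * k) * b j) x.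
Proof.
  revert x. induction k as [|k IH]; intros x.
  - simpl. unfold trig_sum. rewrite Rmult_1_l. apply sum_n_Rext; intros j _. ring.
  - replace (2 * S k)%nat with (S (S (2 * k))) by lia.
    simpl Derive_n.
    rewrite (Derive_ext _ (Derive (fun x => (-1) ^ k * trig_sum n
      (fun j => INR j ^ (2 * k) * a j) (fun j => INR j ^ (2 * k) * b j) x))).
    2:{ intros t. apply Derive_ext. exact IH. }
    rewrite (Derive_ext _ (fun x => (-1) ^ k * Derive (trig_sum n
      (fun j => INR j ^ (2 * k) * a j) (fun j => INR j ^ (2 * k) * b j)) x))
      by (intros t; apply Derive_scal).
    rewrite Derive_scal, !Derive_trig_sum.
    change ((-1) ^ S k) with (-1 * (-1) ^ k).
    rewrite (Rmult_comm (-1)), Rmult_assoc. f_equal.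
    unfold trig_sum. rewrite <- sum_n_Rmult_l. apply sum_n_Rext; intros j _.
    simpl. ring.
Qed.

Lemma sup_norm_le (f : R -> R) M : (forall x, Rabs (f x) <= M) -> sup_norm f <= M.
Proof.
  intros H. unfold sup_norm.
  destruct (Lub_Rbar_correct (fun y => exists x, y = Rabs (f x))) as [H1 H2].
  specialize (H1 (Rabs (f 0)) (ex_intro _ 0 eq_refl)).
  specialize (H2 (Finite M)).
  destruct (Lub_Rbar _) as [r| |]; simpl in *; [|destruct H2|destruct H1].
  - apply H2. intros y [x ->]. apply H.
  - intros y [x ->]. apply H.
Qed.

(** The bound M, whatever its value, makes the least upper bound finite, so that
    its projection to R is the least upper bound. *)
Lemma Rabs_le_sup_norm (f : R -> R) M x :
  (forall x, Rabs (f x) <= M) -> Rabs (f x) <= sup_norm f.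
Proof.
  intros H. unfold sup_norm.
  destruct (Lub_Rbar_correct (fun y => exists x, y = Rabs (f x))) as [H1 H2].
  specialize (H1 (Rabs (f x)) (ex_intro _ x eq_refl)).
  specialize (H2 (Finite M)).
  destruct (Lub_Rbar _) as [r| |]; simpl in *; [exact H1|destruct H2|destruct H1].
  intros y [z ->]. apply H.
Qed.

Lemma trig_sum_bounded n a b :
  exists M, forall x, Rabs (trig_sum n a b x) <= M.
Proof.
  exists (sum_n (fun j => Rabs (a j) + Rabs (b j)) n). intros x. unfold trig_sum.
  eapply Rle_trans; [apply sum_n_Rabs_le|]. apply sum_n_le. intros j _.
  eapply Rle_trans; [apply Rabs_triang|]. rewrite !Rabs_mult.
  assert (Hc : Rabs (cos (INR j * x)) <= 1) by (apply Rabs_le, COS_bound).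
  assert (Hs : Rabs (sin (INR j * x)) <= 1) by (apply Rabs_le, SIN_bound).
  pose proof (Rabs_pos (a j)). pose proof (Rabs_pos (b j)). nra.
Qed.

Lemma cos_as_trig_sum n :
  (fun t => cos (INR n * t)) =
  trig_sum n (fun j => if Nat.eqb j n then 1 else 0) (fun _ => 0).
Proof.
  apply functional_extensionality; intros x. unfold trig_sum.
  rewrite <- (sum_n_select (fun j => cos (INR j * x)) n n (le_n n)) at 1.
  apply sum_n_Rext; intros j _. destruct (Nat.eqb j n); ring.
Qed.

(** The integral defining the factor is nonnegative, so the supremum is attained
    at x = 0. *)
Lemma W_cos k n h : (0 < k)%nat -> (0 < n)%nat -> 0 < h < PI -> INR n * h / 2 <= PI ->
  W k (fun t => cos (INR n * t)) h = freq_mult k h n.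
Proof.
  intros Hk Hn Hh Hnh.
  assert (Hn' : 0 < INR n) by (apply lt_0_INR; exact Hn).
  assert (Hp : 0 <= freq_mult k h n).
  { unfold freq_mult, kernel_integral. destruct (Nat.eqb n 0); [lra|].
    apply Rmult_le_pos; [apply Rlt_le, Rinv_0_lt_compat, Binomial_C_pos|].
    assert (Hy : 0 < INR n * h / 2)
      by (apply Rdiv_lt_0_compat; [apply Rmult_lt_0_compat|]; lra).
    pose proof (sin_int2_pos (2 * k) (INR n * h / 2) ltac:(lra)).
    pose proof (pow_lt 2 (2 * k) ltac:(lra)).
    apply Rdiv_le_0_compat; [|apply pow_lt; lra].
    apply Rmult_le_pos; lra. }
  assert (HW : forall x,
    W_at k (fun t => cos (INR n * t)) x h = freq_mult k h n * cos (INR n * x)).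
  { intros x. change (cos (INR n * x)) with ((fun t => cos (INR n * t)) x).
    rewrite cos_as_trig_sum, W_at_trig_sum by assumption.
    unfold trig_sum. rewrite <- sum_n_Rmult_l. apply sum_n_Rext; intros j _.
    destruct (Nat.eqb_spec j n) as [->|_]; ring. }
  assert (HB : forall x, Rabs (W_at k (fun t => cos (INR n * t)) x h) <= freq_mult k h n).
  { intros x. rewrite HW, Rabs_mult, (Rabs_pos_eq _ Hp).
    assert (Hc : Rabs (cos (INR n * x)) <= 1) by (apply Rabs_le, COS_bound). nra. }
  apply Rle_antisym.
  - apply sup_norm_le. exact HB.
  - pose proof (Rabs_le_sup_norm _ _ 0 HB) as H. unfold W.
    eapply Rle_trans; [|exact H].
    cbv beta. rewrite HW, Rmult_0_r, cos_0, Rmult_1_r. apply Rle_abs.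
Qed.

(** * The multiplier from W to the derivative *)

(** The frequency 0 is annihilated by both operators, so the value there is
    arbitrary; repeating the value at 1 keeps the sequence convex and
    nondecreasing. *)
Definition convex_seq (k : nat) (h : R) (m : nat) : R :=
  Binomial.C (2 * k) k / (2 * h ^ (2 * k))
  * power_ratio (2 * k) (INR (Nat.max 1 m) * h / 2).

Lemma convex_seq_spec k h m : (0 < k)%nat -> 0 < h -> INR m * h / 2 <= PI ->
  convex_seq k h m * freq_mult k h m = INR m ^ (2 * k).
Proof.
  intros Hk Hh Hm. unfold freq_mult. destruct (Nat.eqb_spec m 0) as [->|H0].
  - simpl INR. rewrite !Rmult_0_r, pow_ne_zero by lia. reflexivity.
  - assert (Hm' : 0 < INR m) by (apply lt_0_INR; lia).
    unfold convex_seq, kernel_integral, power_ratio.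
    replace (Nat.max 1 m) with m by lia.
    set (y := INR m * h / 2) in *.
    assert (Hy : 0 < y) by (apply Rdiv_lt_0_compat; [apply Rmult_lt_0_compat|]; lra).
    pose proof (sin_int2_pos (2 * k) y ltac:(lra)).
    pose proof (Binomial_C_pos (2 * k) k).
    pose proof (pow_lt h (2 * k) ltac:(lra)).
    replace (INR m) with (2 * y / h) by (unfold y; field; lra).
    unfold Rdiv at 4. rewrite !Rpow_mult_distr, pow_inv, pow_add.
    field; lra.
Qed.

Lemma convex_seq_nonneg k h m : (0 < k)%nat -> 0 < h ->
  INR (Nat.max 1 m) * h / 2 <= PI -> 0 <= convex_seq k h m.
Proof.
  intros Hk Hh Hm. unfold convex_seq, power_ratio.
  assert (Hm' : 0 < INR (Nat.max 1 m)) by (apply lt_0_INR; lia).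
  set (y := INR (Nat.max 1 m) * h / 2) in *.
  assert (Hy : 0 < y) by (apply Rdiv_lt_0_compat; [apply Rmult_lt_0_compat|]; lra).
  pose proof (sin_int2_pos (2 * k) y ltac:(lra)).
  pose proof (Binomial_C_pos (2 * k) k).
  pose proof (pow_lt h (2 * k) ltac:(lra)).
  apply Rmult_le_pos; apply Rdiv_le_0_compat; try lra. apply pow_le; lra.
Qed.

Lemma convex_seq_convex k n h m : (0 < k)%nat -> 0 < h -> INR n * h / 2 <= PI ->
  (m < n)%nat -> 0 <= second_diff (convex_seq k h) m.
Proof.
  intros Hk Hh Hn Hm. unfold second_diff.
  assert (Hc : 0 <= Binomial.C (2 * k) k / (2 * h ^ (2 * k))).
  { pose proof (Binomial_C_pos (2 * k) k). pose proof (pow_lt h (2 * k) ltac:(lra)).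
    apply Rdiv_le_0_compat; lra. }
  assert (HS : INR (S m) * h / 2 <= PI).
  { apply Rle_trans with (2 := Hn). apply le_INR in Hm.
    apply Rmult_le_compat_r; [lra|]. apply Rmult_le_compat_r; lra. }
  destruct m as [|[|m]].
  - unfold convex_seq. simpl Nat.max. simpl pred. lra.
  - unfold convex_seq. simpl Nat.max. simpl pred.
    pose proof (power_ratio_mono (2 * k) (INR 1 * h / 2) (INR 2 * h / 2) ltac:(lia)) as H.
    change (INR 2) with 2 in *. change (INR 1) with 1 in *.
    specialize (H ltac:(lra) ltac:(lra)).
    enough (0 <= Binomial.C (2 * k) k / (2 * h ^ (2 * k)) *
       (power_ratio (2 * k) (2 * h / 2) - power_ratio (2 * k) (1 * h / 2))) by lra.
    apply Rmult_le_pos; lra.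
  - unfold convex_seq.
    replace (Nat.max 1 (S (S (S m)))) with (S (S (S m))) by lia.
    replace (Nat.max 1 (S (S m))) with (S (S m)) by lia.
    replace (Nat.max 1 (pred (S (S m)))) with (S m) by (simpl; lia).
    pose proof (lt_0_INR (S m) ltac:(lia)) as Hm0.
    assert (E1 : INR (S (S m)) = INR (S m) + 1) by apply S_INR.
    assert (E2 : INR (S (S (S m))) = INR (S m) + 2) by (rewrite S_INR, E1; ring).
    rewrite E2 in *. rewrite E1.
    pose proof (power_ratio_convex (2 * k) (INR (S m) * h / 2) ((INR (S m) + 1) * h / 2)
      ((INR (S m) + 2) * h / 2) ltac:(lia)) as H.
    assert (Hx : 0 < INR (S m) * h) by (apply Rmult_lt_0_compat; lra).
    specialize (H ltac:(lra) ltac:(field) ltac:(lra)).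
    enough (0 <= Binomial.C (2 * k) k / (2 * h ^ (2 * k)) *
       (power_ratio (2 * k) (INR (S m) * h / 2)
        + power_ratio (2 * k) ((INR (S m) + 2) * h / 2)
        - 2 * power_ratio (2 * k) ((INR (S m) + 1) * h / 2))) by lra.
    apply Rmult_le_pos; lra.
Qed.

(** * The inequality *)

Theorem theorem1 (k n : nat) (tau : R -> R) (h : R)
  (hk : (0 < k)%nat) (hn : (0 < n)%nat) (htau : trig_poly n tau)
  (h0 : 0 < h) (hhn : h <= 2 * PI / INR n) (hhk : h < PI / INR k) :
  sup_norm (Derive_n tau (2 * k)) <=
    INR n ^ (2 * k) * / W k (fun t => cos (INR n * t)) h * W k tau h.
Proof.
  assert (hn' : 0 < INR n) by (apply lt_0_INR; exact hn).
  assert (hh : 0 < h < PI).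
  { split; [exact h0|]. apply Rlt_le_trans with (1 := hhk).
    pose proof PI_RGT_0. apply le_INR in hk. simpl in hk.
    apply Rle_div_l; [lra|]. nra. }
  assert (hnh : INR n * h / 2 <= PI).
  { apply Rle_div_r in hhn; [|exact hn']. lra. }
  destruct htau as [a [b htau]].
  assert (E : tau = trig_sum n a b) by (apply functional_extensionality; exact htau).
  subst tau. clear htau.
  set (a' := fun j => freq_mult k h j * a j).
  set (b' := fun j => freq_mult k h j * b j).
  assert (HB : forall x, Rabs (trig_sum n a' b' x) <= W k (trig_sum n a b) h).
  { intros x. destruct (trig_sum_bounded n a' b') as [M HM].
    unfold a', b'. rewrite <- W_at_trig_sum by assumption.
    apply (Rabs_le_sup_norm (fun x => W_at k (trig_sum n a b) x h) M).
    intros y. rewrite W_at_trig_sum by assumption. apply HM. }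
  assert (Hle : forall m, (m <= n)%nat -> INR m * h / 2 <= PI).
  { intros m Hm. apply Rle_trans with (2 := hnh). apply le_INR in Hm.
    apply Rmult_le_compat_r; [lra|]. apply Rmult_le_compat_r; lra. }
  rewrite W_cos by assumption.
  pose proof (convex_seq_spec k h n hk h0 hnh) as Hn.
  assert (Hpos : 0 < INR n ^ (2 * k)) by (apply pow_lt; exact hn').
  assert (Hf : freq_mult k h n <> 0) by (intros H; rewrite H in Hn; lra).
  rewrite <- Hn.
  replace (convex_seq k h n * freq_mult k h n * / freq_mult k h n)
    with (convex_seq k h n) by (field; exact Hf).
  apply sup_norm_le. intros x. rewrite Derive_n_trig_sum, Rabs_mult, pow_1_abs, Rmult_1_l.
  replace (trig_sum n (fun j => INR j ^ (2 * k) * a j) (fun j => INR j ^ (2 * k) * b j) x)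
    with (trig_sum n (fun j => convex_seq k h j * a' j)
                     (fun j => convex_seq k h j * b' j) x).
  - apply convex_multiplier_bound; [exact hn| | |exact HB].
    + intros m Hm. apply convex_seq_nonneg; [exact hk|exact h0|].
      apply Hle. lia.
    + intros m Hm. apply (convex_seq_convex k n); assumption.
  - unfold trig_sum. apply sum_n_Rext; intros j Hj. unfold a', b'.
    rewrite <- (convex_seq_spec k h j hk h0 (Hle j Hj)). ring.
Qed.
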